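(* Let $X:=[-1,1]^d$ and let $P$ be a probability measure on $X\times\{-1,1\}$ with fixed version $\eta\colon X\to[0,1]$ of its posterior probability. Assume that the associated distance to the decision boundary $\Delta_\eta$ controls the noise from below by the exponent $\gamma\in[0,\infty)$, and that $P$ has margin-noise exponent (MNE) $\beta\in(0,\infty]$ and margin exponent (ME) $\alpha\in(0,\infty]$. Furthermore, let $X_0=\partial_XX_1=\partial_XX_{-1}$ with $\mathcal H^{d-1}(X_0)>0$ and let $X_0$ be $(d-1)$-rectifiable. Assume $\beta\le\gamma^{-1}\kappa$, where $\kappa:=(1+\gamma)(\alpha+\gamma)$. Let $S_n$ be a finite subset of $(0,1]$ such that $S_n$ is an $n^{-1/d}$-net of $(0,1]$, and assume that the cardinality of $S_n$ grows at most polynomially in $n$. Then the training validation histogram rule (TV-HR), which produces the decision function $h_{D_1,s^*_{D_2}}$, learns (with respect to the classification loss) with rate $$n^{-\frac{\beta\kappa}{\beta(\kappa+\gamma^2)+d\kappa}}.$$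
   Context: **Data, loss, risks.** $Y:=\{-1,1\}$; $D=((x_1,y_1),\dots,(x_n,y_n))$ is drawn i.i.d. from $P$, and $P^n$ is the product measure. The classification loss is $L(y,t):=\mathbf 1_{(-\infty,0]}(y\cdot\operatorname{sign}t)$ for $y\in Y$, $t\in\mathbb R$, with $\operatorname{sign}t=1$ for $t\ge0$ and $-1$ for $t<0$. For measurable $f\colon X\to\mathbb R$, $\mathcal R_{L,P}(f):=\int_{X\times Y}L(y,f(x))\,dP(x,y)$, and $\mathcal R^*_{L,P}:=\inf_{f\colon X\to\mathbb R}\mathcal R_{L,P}(f)$ (over measurable $f$); for a data set $D$ of length $n$, $\mathcal R_{L,D}(f):=\frac1n\sum_{i=1}^nL(y_i,f(x_i))$. **Histogram rule.** For $s\in(0,1]$ let $\mathcal A=(A_j)_{j\ge1}$ be a partition of $\mathbb R^d$ into cubes of side length $s$; for $x\in X$ let $A(x)$ be the unique cell with $x\in A(x)$. For a data set $D$ of length $n$ put $f_{D,s}(x):=\frac1n\sum_{i=1}^n\mathbf 1_{\{y_i=1\}}\mathbf 1_{A(x)}(x_i)-\frac1n\sum_{i=1}^n\mathbf 1_{\{y_i=-1\}}\mathbf 1_{A(x)}(x_i)$ and $h_{D,s}:=\operatorname{sign}f_{D,s}$. **TV-HR.** Let $(S_n)$ be a sequence of finite subsets $S_n\subset(0,1]$. For $n\ge4$ let $k:=\lfloor n/2\rfloor+1$, $D_1:=((x_1,y_1),\dots,(x_k,y_k))$ and $D_2:=((x_{k+1},y_{k+1}),\dots,(x_n,y_n))$.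 Compute $h_{D_1,s}$ for $s\in S_n$ and use $D_2$ to determine $s^*_{D_2}\in S_n$ with $s^*_{D_2}:=\arg\min_{s\in S_n}\mathcal R_{L,D_2}(h_{D_1,s})$. The resulting decision function is $h_{D_1,s^*_{D_2}}$. **Learning with rate $a_n$.** For every $\varepsilon\in(0,1)$ there is a constant $c_\varepsilon>0$ such that, for all sufficiently large $n$, $\mathcal R_{L,P}(h_{D_1,s^*_{D_2}})-\mathcal R^*_{L,P}\le c_\varepsilon a_n$ holds with probability $P^n\ge1-\varepsilon$. **Posterior probability and decision boundary.** $P_X$ is the marginal distribution of $P$ on $X$; $\eta(x)=P(y=1|x)$. $X_1:=\{x\in X:\eta(x)>1/2\}$, $X_{-1}:=\{x\in X:\eta(x)<1/2\}$, $X_0:=\{x\in X:\eta(x)=1/2\}$. $\partial_XT$ is the relative boundary of $T$ in $X$. The distance to the decision boundary $\Delta_\eta\colon X\to[0,\infty]$ is $\Delta_\eta(x):=d(x,X_1)$ if $x\in X_{-1}$, $\Delta_\eta(x):=d(x,X_{-1})$ if $x\in X_1$, and $\Delta_\eta(x):=0$ otherwise, where $d(x,A):=\inf_{x'\in A}d(x,x')$ and $d(x,x')=\|x-x'\|_\infty$. **Exponents.** $P$ has ME $\alpha\in(0,\infty]$ if there is a constant $c_{\mathrm{ME}}>0$ with $P_X(\{\Delta_\eta(x)<t\})\le(c_{\mathrm{ME}}t)^\alpha$ for all $t>0$. $P$ has MNE $\beta\in(0,\infty]$ if there is a constant $c_{\mathrm{MNE}}>0$ with $\int_{\{\Delta_\eta<t\}}|2\eta(x)-1|\,dP_X(x)\le(c_{\mathrm{MNE}}t)^\beta$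 for all $t>0$. $\Delta_\eta$ controls the noise from below by the exponent $\gamma\in[0,\infty)$ if there is a constant $c_{\mathrm{LC}}>0$ with $\Delta_\eta^\gamma(x)\le c_{\mathrm{LC}}|2\eta(x)-1|$ for $P_X$-almost all $x\in X$. **Geometry and nets.** $\mathcal H^{d-1}$ is the $(d-1)$-dimensional Hausdorff measure on $\mathbb R^d$. A set $T\subset X$ is $m$-rectifiable for an integer $m>0$ if there is a Lipschitz function mapping some bounded subset of $\mathbb R^m$ onto $T$. $S_n$ is an $\epsilon$-net of $(0,1]$ if every point of $(0,1]$ is within distance $\epsilon$ of a point of $S_n$.
   Formalization: For β=∞ the exponent is ∞/∞ and its limit rate n^{-1} fails in general (a log n factor can occur), so there the rate is stated for every finite b>0 in place of β; for α=∞ (κ=∞) with finite β the exponent is read as its limit β/(β+d). *)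

(* Defs.v *)
From HB Require Import structures.
From mathcomp Require Import all_boot all_order all_algebra finmap.
From mathcomp Require Import all_classical all_reals all_analysis.

Set Implicit Arguments.
Unset Strict Implicit.
Unset Printing Implicit Defensive.

Import Order.TTheory GRing.Theory Num.Theory.
Import numFieldNormedType.Exports.

Local Open Scope classical_set_scope.
Local Open Scope ring_scope.

(* R^d is 'rV[R]_d: the library norm on it is the sup-norm and its topology is
   the usual one; the instance below equips it with the Borel sigma-algebra. *)
HB.instance Definition _ (R : realType) (d : nat) :=
  @isMeasurable.Build (sigma_display (@open 'rV[R]_d)) 'rV[R]_d
    <<s @open 'rV[R]_d >>
    (@sigma_algebra0 _ setT _) (@sigma_algebraC _ _) (@sigma_algebra_bigcup _ setT _).

Section product_power.
Context {d : measure_display} {T : measurableType d} {R : realType}.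

Definition tcons n (z : T * n.-tuple T) : n.+1.-tuple T :=
  [the n.+1.-tuple T of z.1 :: z.2].

Lemma measurable_tcons n : measurable_fun setT (@tcons n).
Proof. exact: measurable_cons. Qed.

HB.instance Definition _ n :=
  isMeasurableFun.Build _ _ _ _ (@tcons n) (@measurable_tcons n).

(* The n-fold product measure P^n on n-tuples, built from the binary product. *)
Fixpoint prob_pow (P : probability T R) (n : nat) : probability (n.-tuple T) R :=
  match n with
  | 0%N => \d_([tuple] : 0.-tuple T)
  | n'.+1 => distribution (P \x prob_pow P n')%E (@tcons n')
  end.

Lemma prob_pow_box (P : probability T R) n (B : 'I_n -> set T) :
  (forall i, measurable (B i)) ->
  prob_pow P n [set t | forall i, B i (tnth t i)] = (\prod_(i < n) P (B i))%E.
Proof.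
elim: n B => [|n IHn] B mB /=.
  by rewrite big_ord0 diracE mem_set//; case.
rewrite /distribution /pushforward.
rewrite (_ : _ @^-1` _ =
    B ord0 `*` [set t | forall i, B (lift ord0 i) (tnth t i)]); last first.
  apply/seteqP; split => [[x t] /= H|[x t] /= [B0 H] i].
    split; first by have := H ord0.
    by move=> i; have := H (lift ord0 i); rewrite /tcons tnthS.
  have [j ->|->//] := unliftP ord0 i.
  by rewrite /tcons tnthS; exact: H.
have mB' : measurable [set t : n.-tuple T |
    forall i, B (lift ord0 i) (tnth t i)].
  rewrite (_ : mkset _ = \bigcap_(i in setT)
      ((fun t : n.-tuple T => tnth t i) @^-1` B (lift ord0 i))); last first.
    by apply/seteqP; split => t /= H i; [move=> _|]; exact: H.
  apply: fin_bigcap_measurable; first exact: finite_finset.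
  move=> i _; rewrite -[X in measurable X]setTI.
  exact: (measurable_tnth i).
rewrite big_ord_recl -(IHn (fun i => B (lift ord0 i)))//.
exact: product_measure1E.
Qed.

End product_power.

Section definitions.
Context {R : realType} {d : nat}.
Local Notation E := 'rV[R]_d.
(* Labels: true stands for 1 and false for -1. *)
Local Notation Z := (E * bool)%type.

Definition label (y : bool) : R := if y then 1 else -1.

Definition cubeX : set E := [set x | forall i, -1 <= x ord0 i <= 1].

Definition sign (t : R) : R := if 0 <= t then 1 else -1.

Definition loss (y : bool) (t : R) : R := \1_`]-oo, 0] (label y * sign t).

Definition risk (P : probability Z R) (f : E -> R) : \bar R :=
  (\int[P]_(z in cubeX `*` setT) (loss z.2 (f z.1))%:E)%E.

Definition bayes_risk (P : probability Z R) : \bar R :=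
  ereal_inf [set risk P f | f in [set f | measurable_fun cubeX f]].

Definition emp_risk (D : seq Z) (f : E -> R) : R :=
  (size D)%:R^-1 * \sum_(z <- D) loss z.2 (f z.1).

(* Each edge may be open, closed or half-open:
   BSide true a / BSide false a include / exclude a as a left endpoint,
   and the converse as a right endpoint. *)
Definition is_cube (s : R) (C : set E) : Prop :=
  exists (a : E) (bl br : 'I_d -> bool),
    C = [set x | forall i,
           x ord0 i \in Interval (BSide (bl i) (a ord0 i))
                                 (BSide (br i) (a ord0 i + s))].

Definition cube_partition (s : R) (A : nat -> set E) : Prop :=
  [/\ forall j, is_cube s (A j), trivIset setT A & \bigcup_j A j = setT].

Definition cell (A : nat -> set E) (x : E) : set E :=
  [set x' | exists2 j, A j x & A j x'].

Definition hist_fun (A : nat -> set E) (D : seq Z) (x : E) : R :=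
  (size D)%:R^-1 * (\sum_(z <- D) (z.2 == true)%:R * \1_(cell A x) z.1)
  - (size D)%:R^-1 * (\sum_(z <- D) (z.2 == false)%:R * \1_(cell A x) z.1).

Definition hist (A : nat -> set E) (D : seq Z) (x : E) : R :=
  sign (hist_fun A D x).

Definition train (D : seq Z) : seq Z := take (size D)./2.+1 D.
Definition valid (D : seq Z) : seq Z := drop (size D)./2.+1 D.

(* [sstar] selects, for each data set of length n >= 4, a minimizer over S n of
   the empirical risk on the validation part; ties are broken arbitrarily. *)
Definition TV_selector (A : R -> nat -> set E) (S : nat -> {fset R})
    (sstar : forall n, n.-tuple Z -> R) : Prop :=
  forall n, (4 <= n)%N -> forall D : n.-tuple Z,
    sstar n D \in S n /\
    forall s, s \in S n ->
      emp_risk (valid D) (hist (A (sstar n D)) (train D))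
      <= emp_risk (valid D) (hist (A s) (train D)).

Definition TV_HR (A : R -> nat -> set E) (sstar : forall n, n.-tuple Z -> R)
    (n : nat) (D : n.-tuple Z) : E -> R :=
  hist (A (sstar n D)) (train D).

(* For a measurable event F this says p <= Q F; for arbitrary F it says that F
   has inner probability at least p. *)
Definition with_prob_ge d' (T : measurableType d') (Q : probability T R)
    (F : set T) (p : R) : Prop :=
  exists F', [/\ measurable F', F' `<=` F & (p%:E <= Q F')%E].

Definition learns_with_rate (P : probability Z R)
    (h : forall n, n.-tuple Z -> E -> R) (a : nat -> R) : Prop :=
  forall eps, 0 < eps < 1 -> exists2 c, 0 < c &
    \forall n \near \oo,
      with_prob_ge (prob_pow P n)
        [set D | (risk P (h n D) - bayes_risk P <= (c * a n)%:E)%E] (1 - eps).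

HB.instance Definition _ :=
  isMeasurableFun.Build _ _ _ _ (@fst E bool) measurable_fst.

Definition marginalX (P : probability Z R) : probability E R :=
  distribution P (@fst E bool).

Definition is_posterior (P : probability Z R) (eta : E -> R) : Prop :=
  [/\ measurable_fun cubeX eta,
      forall x, cubeX x -> 0 <= eta x <= 1 &
      forall B, measurable B -> B `<=` cubeX ->
        P (B `*` [set true]) = (\int[marginalX P]_(x in B) (eta x)%:E)%E].

Definition Xpos (eta : E -> R) : set E := [set x | cubeX x /\ eta x > 1/2].
Definition Xneg (eta : E -> R) : set E := [set x | cubeX x /\ eta x < 1/2].
Definition Xzero (eta : E -> R) : set E := [set x | cubeX x /\ eta x = 1/2].

(* Boundary of T relative to the subspace cubeX. *)
Definition rel_boundary (T : set E) : set E :=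
  cubeX `&` closure T `&` closure (cubeX `\` T).

Definition dist_set (x : E) (B : set E) : \bar R :=
  ereal_inf [set (`|x - x'|)%:E | x' in B].

Definition Delta (eta : E -> R) (x : E) : \bar R :=
  if x \in Xneg eta then dist_set x (Xpos eta)
  else if x \in Xpos eta then dist_set x (Xneg eta)
  else 0%E.

Definition near_set (eta : E -> R) (t : R) : set E :=
  [set x | cubeX x /\ (Delta eta x < t%:E)%E].

(* u ^ a for u >= 0 and a in (0, +oo]; u ^ +oo is the limit of u ^ a. *)
Definition powx (u : R) (a : \bar R) : \bar R :=
  match a with
  | a'%:E => (u `^ a')%:E
  | _ => if u < 1 then 0%E else if u == 1 then 1%E else +oo%E
  end.

Definition has_ME (P : probability Z R) (eta : E -> R) (alpha : \bar R) : Prop :=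
  exists2 c : R, 0 < c & forall t : R, 0 < t ->
    (marginalX P (near_set eta t) <= powx (c * t) alpha)%E.

Definition has_MNE (P : probability Z R) (eta : E -> R) (beta : \bar R) : Prop :=
  exists2 c : R, 0 < c & forall t : R, 0 < t ->
    (\int[marginalX P]_(x in near_set eta t) (`|2 * eta x - 1|)%:E
       <= powx (c * t) beta)%E.

Definition controls_noise_below (P : probability Z R) (eta : E -> R)
    (gamma : R) : Prop :=
  exists2 c : R, 0 < c &
    {ae marginalX P, forall x, cubeX x ->
       (Delta eta x `^ gamma <= (c * `|2 * eta x - 1|)%:E)%E}.

Definition enorm2 (x : E) : R := Num.sqrt (\sum_i x ord0 i ^+ 2).

(* The added 0 makes the diameter of the empty set equal to 0. *)
Definition diam2 (B : set E) : \bar R :=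
  ereal_sup ([set 0%E] `|` [set (enorm2 (x - y))%:E | x in B & y in B]).

Definition hausdorff_delta (m : nat) (delta : R) (T : set E) : \bar R :=
  ereal_inf [set (\sum_(0 <= k <oo) diam2 (U k) ^+ m)%E | U in
    [set U : (set E)^nat | T `<=` \bigcup_k U k /\
                           forall k, (diam2 (U k) <= delta%:E)%E]].

(* m-dimensional (m > 0) Hausdorff measure, without the positive normalizing
   constant that makes it agree with Lebesgue measure on m-planes. *)
Definition hausdorff (m : nat) (T : set E) : \bar R :=
  ereal_sup [set hausdorff_delta m delta T | delta in [set delta | 0 < delta]].

Definition rectifiable (m : nat) (T : set E) : Prop :=
  (0 < m)%N /\
  exists (B : set 'rV[R]_m) (f : 'rV[R]_m -> E),
    [/\ bounded_set B, [lipschitz f x | x in B] & f @` B = T].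

End definitions.

Section rates.
Context {R : realType}.

Definition is_net (eps : R) (S : {fset R}) : Prop :=
  forall u : R, 0 < u <= 1 -> exists2 s, s \in S & `|u - s| <= eps.

Definition poly_card (S : nat -> {fset R}) : Prop :=
  exists C k : nat, forall n, (0 < n)%N -> (#|` S n| <= C * n ^ k)%N.

Definition kappa (gamma : R) (alpha : \bar R) : \bar R :=
  ((1 + gamma)%:E * (alpha + gamma%:E))%E.

(* For alpha = +oo, that is kappa = +oo, the value is the limit of the first
   expression as kappa tends to +oo.  beta is finite: for a margin-noise exponent
   +oo the expression is oo/oo, and the rate is asserted for all finite beta. *)
Definition rate_exponent (d : nat) (gamma : R) (alpha : \bar R) (beta : R) : R :=
  match kappa gamma alpha with
  | k%:E => (beta * k) / (beta * (k + gamma ^+ 2) + d%:R * k)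
  | _ => beta / (beta + d%:R)
  end.

End rates.

(* Main.v *)
Require Import Defs.
From mathcomp Require Import all_boot all_order all_algebra finmap.
From mathcomp Require Import all_classical all_reals all_analysis.
From mathcomp Require Import measurable_realfun ring lra zify.
Import Order.TTheory GRing.Theory Num.Theory.
Import numFieldNormedType.Exports.
Local Open Scope classical_set_scope.
Local Open Scope ring_scope.

(** The excess risk of a decision function is the integral of |2 eta - 1| over
    the set where it disagrees with the Bayes rule.  For the histogram of side
    length s ~ n^-sigma, a cell meeting both classes lies within distance 2 s of
    the decision boundary, so by MNE all such cells together cost O(s^beta).
    On any other cell, with mass p and noise M, the empirical sign is wrong with
    probability at most 8 p / (k M^2), k being the training size.  Cells at distance
    at least t = n^-theta from the boundary have p <= c t^-gamma M by the lower
    noise control, and there are O(s^-d) of them; the cells closer to the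
    boundary number only O(t s^-d) because X_0 is rectifiable, and for these
    p <= P_X(A, Delta < tau) + c tau^-gamma M with tau ~ n^-phi, the first term
    summing to O(tau^alpha) by ME.  The exponents sigma, theta, phi balance all
    contributions at n^-r; the assumption beta <= kappa / gamma says s <= t.
    For the validation step, the same inequality bounds the variance of the loss
    difference of two candidates by a + b (sum of their excess risks), which
    gives a Bernstein-type bound of order log |S_n| tau^-gamma / n + tau^(alpha + gamma).
    The second term is of order n^-r and the first one is smaller, because
    beta <= kappa / gamma < d kappa / gamma. *)

(** * Product measures *)

Section prob_tools.
Context {d : measure_display} {T : measurableType d} {R : realType}.
Implicit Types (P : probability T R) (n k : nat).

(** Events are sets of sequences rather than of tuples, so that one [Q] serves at every length and
    no cast between tuple types occurs. *)
Lemma prob_powSE P n (Q : set (seq T)) :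
  prob_pow P n.+1 [set D : n.+1.-tuple T | Q D] =
  (\int[P]_z prob_pow P n [set D : n.-tuple T | Q (z :: D)])%E.
Proof.
rewrite /= /distribution /pushforward /= /product_measure1.
apply: eq_integral => z _ /=; congr (prob_pow _ _ _).
by apply/seteqP; split => D; rewrite /xsection /= inE.
Qed.

Lemma measurable_section_cons n (Q : set (seq T)) z :
  measurable [set D : n.+1.-tuple T | Q D] ->
  measurable [set D : n.-tuple T | Q (z :: D)].
Proof.
move=> mQ.
have := @measurable_tcons _ T n measurableT _ mQ; rewrite setTI.
move=> /measurable_xsection => /(_ z).
by congr (measurable _); apply/seteqP; split => D; rewrite /xsection /= inE.
Qed.

Lemma measurable_prob_section P n (Q : set (seq T)) :
  measurable [set D : n.+1.-tuple T | Q D] ->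
  measurable_fun [set: T]
    (fun z => prob_pow P n [set D : n.-tuple T | Q (z :: D)] : \bar R).
Proof.
move=> mQ.
have := @measurable_tcons _ T n measurableT _ mQ; rewrite setTI.
move=> /(measurable_fun_xsection (prob_pow P n)).
apply: eq_measurable_fun => z _ /=; congr (prob_pow _ _ _).
by apply/seteqP; split => D; rewrite /xsection /= inE.
Qed.

(** Conditioning on the first [k] points, by integrating them out one at a time. It is used to
    freeze the training part, after which the classifiers compared on the validation part are
    fixed. *)
Lemma prob_pow_le_prefix P n k (Q : set (seq T)) (e : \bar R) :
  (k <= n)%N ->
  measurable [set D : n.-tuple T | Q D] ->
  (forall u, size u = k ->
    prob_pow P (n - k) [set D : (n - k).-tuple T | Q (u ++ D)] <= e)%E ->
  (prob_pow P n [set D : n.-tuple T | Q D] <= e)%E.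
Proof.
move=> kn; elim: k n kn Q => [|k IH] [|n] // kn Q mQ H.
- exact: (H [::]).
- by have := H [::] erefl; rewrite subn0; exact.
- rewrite prob_powSE.
  have -> : e = (\int[P]_z (cst e) z)%E.
    by rewrite integral_cst// [X in (_ * X)%E]probability_setT mule1.
  have He z : (prob_pow P n [set D : n.-tuple T | Q (z :: D)] <= e)%E.
    apply: (IH n kn (fun u => Q (z :: u))); first exact: measurable_section_cons.
    by move=> u uk; exact: (H (z :: u) (congr1 S uk)).
  apply: ge0_le_integral => //.
  exact: measurable_prob_section.
Qed.

Lemma sum_take_ord n k (D : n.-tuple T) (F : T -> R) :
  \sum_(z <- take k D) F z = \sum_(i < n | (i < k)%N) F (tnth D i).
Proof.
elim: n k D => [|n IH] k D; first by rewrite tuple0 big_nil big_ord0.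
case/tupleP: D => z D /=; case: k => [|k].
  by rewrite big_nil big_pred0.
rewrite big_cons IH [RHS]big_mkcond big_ord_recl /= tnth0; congr (_ + _).
by rewrite big_mkcond; apply: eq_bigr => i _; rewrite tnthS.
Qed.

Lemma sum_drop_ord n k (D : n.-tuple T) (F : T -> R) :
  \sum_(z <- drop k D) F z = \sum_(i < n | ~~ (i < k)%N) F (tnth D i).
Proof.
apply: (@addrI _ (\sum_(z <- take k D) F z)).
rewrite -big_cat /= cat_take_drop sum_take_ord big_tuple.
by rewrite [LHS](bigID (fun i : 'I_n => (i < k)%N)).
Qed.

Lemma measurable_sum_take n k (V : T -> R) :
  measurable_fun setT V -> measurable_fun setT
    (fun D : n.-tuple T => \sum_(z <- take k D) V z).
Proof.
move=> mV; under eq_fun do rewrite sum_take_ord big_mkcond.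
apply: measurable_sum => i; case: (i < k)%N => //.
by apply: (measurableT_comp mV); exact: measurable_tnth.
Qed.

(* The exponential Markov inequality, by induction on [n] so that only
   one-variable integrals occur. *)
Lemma prob_pow_sum_le P n k (V : T -> R) (l q th : R) :
  (k <= n)%N -> measurable_fun setT V -> 0 <= l -> 0 <= q ->
  (\int[P]_z (expR (- (l * V z)))%:E <= q%:E)%E ->
  (prob_pow P n [set D : n.-tuple T | (\sum_(z <- take k D) V z <= th)%R]
    <= (expR (l * th) * q ^+ k)%:E)%E.
Proof.
move=> kn mV l0 q0 Hq; elim: k n kn th => [|k IH] n kn th.
  rewrite expr0 mulr1; have [th0|th0] := leP 0 th.
    apply: (le_trans (probability_le1 _ _)).
      by rewrite -[X in measurable X]setTI; apply: measurable_fun_le => //;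
        exact: measurable_sum_take.
    by rewrite lee_fin -expR0 ler_expR mulr_ge0.
  rewrite (_ : mkset _ = set0) ?measure0 ?lee_fin ?expR_ge0//.
  by apply/seteqP; split => // D /=; rewrite take0 big_nil leNgt th0.
case: n kn => // n kn.
rewrite (prob_powSE P n (fun D => \sum_(z <- take k.+1 D) V z <= th)).
have He z : (prob_pow P n [set D : n.-tuple T | (\sum_(z <- take k.+1 (z :: D)) V z <= th)%R]
   <= (expR (l * th) * q ^+ k)%:E * (expR (- (l * V z)))%:E)%E.
  rewrite (_ : mkset _ = [set D : n.-tuple T | (\sum_(z <- take k D) V z <= th - V z)%R]);
    last first.
    by apply/seteqP; split => D /=; rewrite big_cons lerBrDl.
  apply: (le_trans (IH n kn _)); rewrite -EFinM lee_fin mulrBr expRD.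
  by rewrite -!mulrA [expR (- _) * _]mulrC.
have me : measurable_fun setT (fun z => (expR (- (l * V z)))%:E).
  apply/measurable_EFinP; apply: measurableT_comp => //; apply: measurableT_comp => //.
  exact: measurable_funM.
apply: (@le_trans _ _ (\int[P]_z ((expR (l * th) * q ^+ k)%:E * (expR (- (l * V z)))%:E))%E).
  apply: ge0_le_integral => //.
  - apply: (@measurable_prob_section P n (fun D => \sum_(z <- take k.+1 D) V z <= th)).
    by rewrite -[X in measurable X]setTI; apply: measurable_fun_le => //;
      exact: measurable_sum_take.
  - by apply: emeasurable_funM.
rewrite ge0_integralZl//; last by rewrite lee_fin mulr_ge0 ?expR_ge0 ?exprn_ge0.
rewrite exprSr mulrA [X in (_ <= X)%E]EFinM lee_wpmul2l//.
by rewrite lee_fin mulr_ge0 ?expR_ge0 ?exprn_ge0.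
Qed.

(** Both bounds invert [1 + y <= expR y], at [y = - x] and at [y = x]. For the first one, the
    constant 2 works because [1 + x + 2 * x ^+ 2] times [1 - x] is [1 + x ^+ 2 * (1 - 2 * x)]. *)
Lemma expR_le_quad (x : R) : 0 <= x <= 2^-1 ->
  expR x <= 1 + x + 2 * x ^+ 2 /\ expR (- x) <= 1 - x + 2 * x ^+ 2.
Proof.
move=> /andP[x0 x1]; split.
  have := expR_ge1Dx (- x); rewrite expRN => H.
  rewrite -[expR x]invrK; apply: (@le_trans _ _ ((1 - x)^-1)).
    by rewrite lef_pV2// ?posrE ?invr_gt0 ?expR_gt0//; lra.
  rewrite -[X in X <= _]mul1r ler_pdivrMr; last lra.
  by rewrite !expr2; nra.
rewrite expRN; apply: (@le_trans _ _ ((1 + x)^-1)).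
  by rewrite lef_pV2 ?posrE ?expR_gt0 ?expR_ge1Dx//; lra.
rewrite -[X in X <= _]mul1r ler_pdivrMr; last lra.
by rewrite !expr2; nra.
Qed.

(** A Chernoff bound of Bernstein type: each summand is 1, -1 or 0, so its second moment is the mass
    of the symmetric difference of [L1] and [L2]. The tilt [l] stays free and is chosen at each
    use. *)
Lemma prob_pow_indic_sum_le0 P n k (L1 L2 : set T) (l : R) :
  (k <= n)%N -> measurable L1 -> measurable L2 -> 0 <= l <= 2^-1 ->
  (prob_pow P n [set D : n.-tuple T |
      (\sum_(z <- take k D) (\1_L1 z - \1_L2 z : R) <= 0)%R] <=
   (expR (k%:R * (2 * l ^+ 2 * (fine (P (L1 `\` L2)) + fine (P (L2 `\` L1)))
       - l * (fine (P L1) - fine (P L2)))))%:E)%E.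
Proof.
move=> kn mL1 mL2 /[dup] l01 /andP[l0 l1].
set B := L1 `\` L2; set C := L2 `\` L1.
have mB : measurable B by exact: measurableD.
have mC : measurable C by exact: measurableD.
have fP X : measurable X -> P X = (fine (P X))%:E.
  by move=> mX; rewrite fineK// fin_num_measure.
set q := expR _; rewrite /= in q *.
pose q1 := expR (2 * l ^+ 2 * (fine (P B) + fine (P C)) - l * (fine (P L1) - fine (P L2))).
have -> : q = expR (l * 0) * q1 ^+ k by rewrite /q /q1 mulr0 expR0 mul1r -expRM_natl.
apply: prob_pow_sum_le => //.
- by apply: measurable_funB; exact: measurable_indic.
- exact: expR_ge0.
(* The two indicators agree on [E], so the exponential is constant on each of [B], [C] and [E], and
   its integral is a sum of three terms. *)
pose E := ~` (B `|` C).
have mE : measurable E by apply: measurableC; exact: measurableU.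
have mI (X : set T) : measurable X -> measurable_fun setT (fun z => (\1_X z : R)%:E).
  by move=> mX; apply/measurable_EFinP; exact: measurable_indic.
have mZ (X : set T) (r : R) : measurable X -> measurable_fun setT (fun z =>
  r%:E * (\1_X z : R)%:E)%E.
  by move=> mX; apply: emeasurable_funM => //; exact: mI.
rewrite (_ : (fun z => (expR (- (l * (\1_L1 z - \1_L2 z))))%:E) =
  (fun z => ((expR (- l))%:E * (\1_B z)%:E + (expR l)%:E * (\1_C z)%:E) + (\1_E z)%:E)%E);
    last first.
  apply/funext => z; rewrite -!EFinM -!EFinD; congr EFin.
  rewrite !indicE !in_setC !in_setU !in_setD.
  by case: (z \in L1); case: (z \in L2) => //=;
    rewrite !(mulr1, mulr0, subr0, sub0r, subrr, oppr0, add0r, addr0, mulrN1, mulrN, opprK,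
      expR0).
have e0 (r : R) (X : set T) z : (0 <= (expR r)%:E * (\1_X z)%:E)%E.
  by rewrite -EFinM lee_fin mulr_ge0 ?expR_ge0.
rewrite ge0_integralD//; [|by move=> z _; apply: adde_ge0|
  by apply: emeasurable_funD; exact: mZ|exact: mI].
rewrite ge0_integralD//; [|exact: mZ|exact: mZ].
rewrite !ge0_integralZl//; try exact: mI; try by rewrite lee_fin expR_ge0.
have iP (X : set T) : measurable X -> (\int[P]_x (\1_X x)%:E = (fine (P X))%:E)%E.
  by move=> mX; rewrite integral_indic// setIT; exact: fP.
rewrite !iP// -!EFinM -!EFinD lee_fin.
have BC0 : B `&` C = set0 by apply/seteqP; split=> z// [[? ?] []].
have -> : fine (P E) = 1 - (fine (P B) + fine (P C)).
  rewrite probability_setC; last exact: measurableU.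
  rewrite measureU// fineB ?fineD// ?fin_numD ?fin_num_measure//.
have mI12 : measurable (L1 `&` L2) by exact: measurableI.
have L1E : fine (P L1) = fine (P B) + fine (P (L1 `&` L2)).
  by rewrite (measureDI P mL1 mL2) fineD// fin_num_measure.
have L2E : fine (P L2) = fine (P C) + fine (P (L1 `&` L2)).
  by rewrite (measureDI P mL2 mL1) fineD// ?fin_num_measure// setIC.
have [ub lb] := expR_le_quad l l01.
have pB : 0 <= fine (P B) by exact: fine_ge0.
have pC : 0 <= fine (P C) by exact: fine_ge0.
apply: le_trans (expR_ge1Dx _).
rewrite L1E L2E; set pb := fine (P B) in pB *; set pc := fine (P C) in pC *.
nra.
Qed.

(** Markov's inequality needs no independence of the events, which suits the errors of different
    cells, since they come from one sample. *)
Lemma markov_indic_sum P (I : Type) (J : seq I) (M : I -> R) (W : I -> set T) (th : R) :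
  0 < th -> (forall j, 0 <= M j) -> (forall j, measurable (W j)) ->
  (P [set x | (th <= \sum_(j <- J) M j * \1_(W j) x)%R] <=
   (th^-1 * \sum_(j <- J) M j * fine (P (W j)))%:E)%E.
Proof.
move=> th0 M0 mW.
have mf j : measurable_fun setT (fun x => (M j * \1_(W j) x : R)).
  by apply: measurable_funM => //; exact: measurable_indic.
set G := mkset _.
have mG : measurable G.
  rewrite /G -[X in measurable X]setTI; apply: measurable_fun_le => //.
  exact: measurable_sum.
have H : (th%:E * P G <= \sum_(j <- J) (M j * fine (P (W j)))%:E)%E.
  rewrite -[X in (X * _)%E]/(cst th%:E tt) -integral_cst//.
  apply: (@le_trans _ _ (\int[P]_x (\sum_(j <- J) (M j * \1_(W j) x)%:E))%E).
    apply: (@le_trans _ _ (\int[P]_(x in G) (\sum_(j <- J) (M j * \1_(W j) x)%:E))%E).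
      apply: ge0_le_integral => //.
      - by move=> x _; rewrite lee_fin ltW.
      - apply: emeasurable_sum => j; apply/measurable_EFinP.
        exact: measurable_funTS.
      - by move=> x; rewrite sumEFin lee_fin.
    apply: ge0_subset_integral => //.
    - by apply: emeasurable_sum => j; exact/measurable_EFinP.
    - by move=> x _; apply: sume_ge0 => j _; rewrite lee_fin mulr_ge0.
  rewrite ge0_integral_sum//.
  - apply: lee_sum => j _.
    under eq_integral do rewrite EFinM.
    rewrite ge0_integralZl//.
    + by rewrite integral_indic// setIT EFinM fineK// fin_num_measure.
    + by apply/measurable_EFinP; exact: measurable_indic.
    + by rewrite lee_fin.
  - by move=> j; exact/measurable_EFinP.
  - by move=> j x _; rewrite lee_fin mulr_ge0.
rewrite EFinM -lee_pdivrMl ?invr_gt0// invrK; first by rewrite -sumEFin.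
Qed.

End prob_tools.

(** * Counting cubes *)

Section cubes.
Context {R : realType} {d : nat}.
Local Notation E := 'rV[R]_d.

Lemma normr_rV_le {n} (x : 'rV[R]_n) (r : R) : 0 <= r ->
  (`|x| <= r) <-> (forall i, `|x ord0 i| <= r).
Proof.
move=> r0; rewrite {1}[ `|x| ]mx_normrE; split => [/bigmax_leP[_ H] i|H].
  exact: (H (ord0, i)).
by apply/bigmax_leP; split => // -[i j] _ /=; rewrite (ord1 i).
Qed.

Lemma normr_coord_le {n} (x : 'rV[R]_n) i : `|x ord0 i| <= `|x|.
Proof. by move: i; apply/normr_rV_le. Qed.

(* Two disjoint cubes have corners differing by at least [s] in some coordinate,
   so rounding the corners down to multiples of [s] is injective. *)
Lemma card_cubes_meeting_ball (A : nat -> set E) (J : {fset nat}) (s r : R) (y : E) :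
  0 < s -> 0 <= r -> (forall j, is_cube s (A j)) -> trivIset setT A ->
  (forall j, j \in J -> exists2 x, A j x & `|x - y| <= r) ->
  (#|` J|)%:R <= (2 * r / s + 2) ^+ d.
Proof.
move=> s0 r0 cA tA HJ.
have [a Ha] := choice cA.
(* A cube of side [s] that meets the ball has its corner between [y - r - s] and [y + r] in every
   coordinate; adding [r + s] makes the quantity nonnegative before truncation. *)
have corner j : j \in J -> forall i, 0 <= (a j ord0 i - y ord0 i + r + s) / s <= 2 * r / s + 1.
  move=> jJ i; have [x Ax xr] := HJ j jJ.
  have [bl [br Aj]] := Ha j.
  have : a j ord0 i <= x ord0 i <= a j ord0 i + s.
    by move: Ax; rewrite Aj => /(_ i); case: (bl i) (br i) => -[];
      rewrite in_itv /= => /andP[? ?]; apply/andP; split; lra.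
  have := le_trans (normr_coord_le (x - y) i) xr; rewrite !mxE ler_norml.
  move=> /andP[h1 h2] /andP[h3 h4]; apply/andP; split.
    by apply: divr_ge0; lra.
  rewrite ler_pdivrMr// mulrDl mul1r divfK ?gt_eqF//; lra.
pose m := Num.trunc (2 * r / s + 1).
pose g (j : J) : {ffun 'I_d -> 'I_m.+1} :=
  [ffun i => inord (Num.trunc ((a (val j) ord0 i - y ord0 i + r + s) / s))].
have ginj : injective g.
  move=> j j' gE; apply/val_inj.
  have close i : `|a (val j) ord0 i - a (val j') ord0 i| < s.
    have := congr1 (fun f : {ffun 'I_d -> 'I_m.+1} => val (f i)) gE.
    have /andP[p0 pm] := corner _ (valP j) i; have /andP[q0 qm] := corner _ (valP j') i.
    rewrite !ffunE /= !inordK ?ltnS ?le_truncn// => tE.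
    have /andP[] := truncn_itv p0; have /andP[] := truncn_itv q0; rewrite tE.
    set u := (Num.trunc _)%:R; rewrite -natr1 -/u ler_pdivlMr// ler_pdivlMr// !ltr_pdivrMr//.
    by rewrite mulrDl mul1r => *; rewrite ltr_norml; apply/andP; split; lra.
  apply: contrapT => /eqP jj'.
  (* The midpoint of the overlap lies strictly between the faces of both cubes, hence in both,
     whichever faces they contain. *)
  pose x : E := \row_i ((a (val j) ord0 i + a (val j') ord0 i + s) / 2).
  have Ax : A (val j) x.
    have [bl [br ->]] := Ha (val j) => i; rewrite mxE.
    by have := close i; rewrite ltr_norml => /andP[? ?]; case: (bl i) (br i) => -[];
      rewrite in_itv /=; apply/andP; split; lra.
  have Ax' : A (val j') x.
    have [bl [br ->]] := Ha (val j') => i; rewrite mxE.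
    by have := close i; rewrite ltr_norml => /andP[? ?]; case: (bl i) (br i) => -[];
      rewrite in_itv /=; apply/andP; split; lra.
  by move/eqP: jj'; apply; apply: (tA _ _ I I); exists x.
have := leq_card g ginj; rewrite card_ffun !card_ord -cardfE -(ler_nat R) => /le_trans; apply.
rewrite natrX lerXn2r ?nnegrE//; first by rewrite addr_ge0// !mulr_ge0// invr_ge0 ltW.
have h : 0 <= 2 * r / s + 1 by rewrite addr_ge0// !mulr_ge0// invr_ge0 ltW.
by have := truncn_le (2 * r / s + 1); rewrite h -natr1 -/m; lra.
Qed.

(** The centres are peeled off one at a time, each removing at most [N] members of [J]. The bound is
    asked of all subsets of [J] so that the induction passes to what remains. *)
Lemma card_fset_cover (I : eqType) (K : choiceType) (ys : seq I) (rel : K -> I -> Prop) (N :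
  R) (J : {fset K}) :
  (forall j, j \in J -> exists2 y, y \in ys & rel j y) ->
  (forall y (J' : {fset K}), (J' `<=` J)%fset ->
     (forall j, j \in J' -> rel j y) -> (#|` J'|)%:R <= N) ->
  (#|` J|)%:R <= (size ys)%:R * N.
Proof.
elim: ys J => [|y ys IH] J cov bd.
  have [->|[j jJ]] := fset_0Vmem J; first by rewrite cardfs0 mul0r.
  by have [y] := cov j jJ.
rewrite -(cardfsID [fset j in J | `[< rel j y >]]%fset J) natrD /= -natr1 mulrDl mul1r addrC.
apply: lerD; last first.
  apply: (bd y); first exact: fsubsetIl.
  by move=> j; rewrite !inE /= => /andP[_ /andP[_ /asboolP]].
apply: IH.
  move=> j; rewrite !inE /= => /andP[/[swap] jJ]; rewrite jJ /= => /asboolPn nr.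
  have [z] := cov j jJ; rewrite inE => /predU1P[->//|zs rz].
  by exists z.
move=> z J' sJ'; apply: bd; apply: fsubset_trans sJ' _; exact: fsubsetDl.
Qed.

(** A grid of mesh [t] is put on the bounded parameter domain and one point per occupied grid cell
    is pushed forward by the Lipschitz map. The constant [C] serves for both the number of points
    and the radius. *)
Lemma rectifiable_cover (m : nat) (T : set E) : rectifiable m T ->
  exists2 C : R, 0 < C & forall t : R, 0 < t <= 1 ->
  exists ys : seq E, (size ys)%:R <= C * (t^-1) ^+ m /\
    forall x, T x -> exists2 y, y \in ys & `|x - y| <= C * t.
Proof.
move=> [m0 [B [f [bB lf fB]]]].
have [M M0 HM] : exists2 M : R, 0 < M & forall x, B x -> `|x| < M.
  exact: (ex_strict_bound_gt0 bB).
have [L L0 HL] : exists2 L : R, 0 < L & forall x y, B x -> B y -> `|f x - f y| <= L * `|x - y|.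
  near (pinfty_nbhs R) => L; exists L => //.
  have : L.-lipschitz_on f (globally (B `*` B)) by near: L.
  by move=> H x y Bx By; exact: (H (x, y) (conj Bx By)).
pose C := (2 * M + 1) ^+ m + L.
have C1 : 0 < (2 * M + 1) ^+ m by apply: exprn_gt0; lra.
exists C; first by rewrite /C; lra.
move=> t /andP[t0 t1].
pose k := Num.trunc (2 * M / t).
pose g (x : 'rV[R]_m) : {ffun 'I_m -> 'I_k.+1} := [ffun i =>
  inord (Num.trunc ((x ord0 i + M) / t))].
(* Grid cells that miss [B] get the dummy representative 0; its image only lengthens the list of
   centres. *)
have /choice[c Hc] : forall w : {ffun 'I_m -> 'I_k.+1}, exists x,
    (exists2 x, B x & g x = w) -> B x /\ g x = w.
  move=> w; have [[x Bx gx]|nx] := pselect (exists2 x, B x & g x = w); first by exists x.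
  by exists 0 => /nx.
exists [seq f (c w) | w <- enum {: {ffun 'I_m -> 'I_k.+1}}]; split.
  rewrite size_map -cardE card_ffun !card_ord natrX.
  apply: (@le_trans _ _ ((2 * M + 1) ^+ m * t^-1 ^+ m)).
    rewrite -exprMn lerXn2r ?nnegrE//; first by rewrite mulr_ge0 ?invr_ge0//; lra.
    have h : 0 <= 2 * M / t by rewrite mulr_ge0 ?invr_ge0//; lra.
    have := truncn_le (2 * M / t); rewrite h -natr1 -/k mulrDl mul1r => hk.
    have : 1 <= t^-1 by rewrite -[X in X <= _]invr1 lef_pV2 ?posrE.
    lra.
  by apply: ler_wpM2r; [rewrite exprn_ge0// invr_ge0 ltW|rewrite /C; lra].
move=> x; rewrite -fB => -[b Bb <-].
have [Bc gc] := Hc (g b) (ex_intro2 _ _ b Bb erefl).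
exists (f (c (g b))); first by apply/mapP; exists (g b); rewrite ?mem_enum.
apply: (le_trans (HL _ _ Bb Bc)).
have LC : L <= C by rewrite /C; lra.
apply: (@le_trans _ _ (L * t)); last by apply: ler_wpM2r => //; exact: ltW.
apply: ler_wpM2l; first exact: ltW.
apply/normr_rV_le; first exact: ltW.
move=> i; rewrite !mxE.
have HB z : B z -> 0 <= (z ord0 i + M) / t <= 2 * M / t.
  move=> Bz; have := le_lt_trans (normr_coord_le z i) (HM z Bz).
  rewrite ltr_norml => /andP[? ?]; apply/andP; split; first by apply: divr_ge0; lra.
  by apply: ler_wpM2r; [rewrite invr_ge0 ltW|lra].
have := congr1 (fun h : {ffun 'I_m -> 'I_k.+1} => val (h i)) gc.
have /andP[p0 pm] := HB _ Bb; have /andP[q0 qm] := HB _ Bc.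
rewrite !ffunE /= !inordK ?ltnS ?le_truncn// => tE.
have /andP[] := truncn_itv p0; have /andP[] := truncn_itv q0; rewrite tE.
set u := (Num.trunc _)%:R; rewrite -natr1 -/u ler_pdivlMr// ler_pdivlMr// !ltr_pdivrMr//.
by rewrite mulrDl mul1r => *; rewrite ler_norml; apply/andP; split; lra.
Unshelve. all: by end_near. Qed.

End cubes.

(** * Geometry of the decision boundary *)

Section margin_geometry.
Context {R : realType} {d : nat}.
Local Notation E := 'rV[R]_d.

(** The boundary point sits on the segment at the supremum of the parameters that give points of
    [T]; convexity of [cubeX] keeps the segment inside. *)
Lemma segment_meets_rel_boundary (T : set E) (x x' : E) :
  cubeX x -> cubeX x' -> T x -> ~ T x' ->
  exists2 y, rel_boundary T y & `|x - y| <= `|x - x'|.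
Proof.
move=> Xx Xx' Tx nTx'.
pose g (l : R) : E := x + l *: (x' - x).
have gB l m : `|g l - g m| = `|l - m| * `|x - x'|.
  rewrite /g opprD addrACA subrr add0r -scalerBl normrZ.
  by rewrite -[X in _ * X]normrN opprB.
have gX l : 0 <= l <= 1 -> cubeX (g l).
  move=> /andP[l0 l1] i; rewrite /g !mxE.
  have /andP[a1 a2] := Xx i; have /andP[b1 b2] := Xx' i.
  by apply/andP; split; nra.
pose L := [set l | 0 <= l <= 1 /\ T (g l)].
have g0 : g 0 = x by rewrite /g scale0r addr0.
have g1 : g 1 = x' by rewrite /g scale1r addrC subrK.
have L0 : L 0 by split; rewrite ?lexx ?ler01// g0.
have supL : has_sup L by split; [exists 0|exists 1 => l [/andP[]]].
pose s := sup L.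
have s0 : 0 <= s by apply: ub_le_sup => //; case: supL.
have s1 : s <= 1 by apply: ge_sup; [exists 0|move=> l [/andP[]]].
have s01 : 0 <= s <= 1 by rewrite s0.
(* Adding 1 to the length of the segment makes [N] a safe divisor. *)
pose N := `|x - x'| + 1.
have N0 : 0 < N by rewrite ltr_wpDl.
have gball l (e : R) : 0 < e -> `|s - l| < e / N -> ball (g s) e (g l).
  move=> e0 sl; rewrite -ball_normE /ball_ /= gB.
  apply: (@le_lt_trans _ _ (`|s - l| * N)).
    by apply: ler_wpM2l => //; rewrite /N; lra.
  by rewrite -ltr_pdivlMr.
exists (g s); last first.
  have := gB 0 s; rewrite g0 sub0r normrN (ger0_norm s0) => ->.
  by rewrite ler_piMl.
split; first split; first exact: gX.
- move=> U /nbhs_ballP[e /= e0 eU].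
  have [|l Ll sl] := @sup_adherent _ L (e / N) _ supL; first by rewrite divr_gt0.
  exists (g l); split; first by case: Ll.
  apply/eU/gball => //; rewrite ger0_norm; last by rewrite subr_ge0; apply: ub_le_sup => //;
    case: supL.
  by rewrite -/s in sl; lra.
- move=> U /nbhs_ballP[e /= e0 eU].
  (* If the supremum is 1, the boundary point is [x'], which is itself outside [T]; otherwise every
     slightly larger parameter leaves [T]. *)
  have [s1E|s1E] := eqVneq s 1.
    by exists (g s); split; [split; [exact: gX|rewrite s1E g1]|exact/eU/ballxx].
  have {}s1 : s < 1 by rewrite lt_neqAle s1E.
  have eN : 0 < e / N / 2 by rewrite !divr_gt0.
  pose l := Num.min 1 (s + e / N / 2).
  have sl : s < l by rewrite /l lt_min s1 ltrDl.
  have l1 : l <= 1 by rewrite /l ge_min lexx.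
  have ls : l <= s + e / N / 2 by rewrite /l ge_min lexx orbT.
  have l01 : 0 <= l <= 1 by rewrite l1 andbT; lra.
  exists (g l); split; first split; first exact: gX.
    move=> Tl; have : l <= s by apply: ub_le_sup => //; case: supL.
    by rewrite leNgt sl.
  apply/eU/gball => //; rewrite distrC ger0_norm; last lra.
  by lra.
Qed.

Context (eta : E -> R).
Hypothesis Xzero_pos : Xzero eta = rel_boundary (Xpos eta).
Hypothesis Xzero_neg : Xzero eta = rel_boundary (Xneg eta).

Lemma near_set_Xzero (t : R) x : 0 < t -> near_set eta t x ->
  exists2 y, Xzero eta y & `|x - y| < t.
Proof.
move=> t0 [Xx]; rewrite /Delta; case: ifPn => [/set_mem xn|/negP xn].
  move=> /ereal_inf_lt[_ [x' x'p <-]]; rewrite lte_fin => xx'.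
  have [||||y yb xy] := @segment_meets_rel_boundary (Xneg eta) x x' => //.
  - by case: x'p.
  - by case: x'p => _ h [_]; rewrite ltNge (ltW h).
  - by exists y; [rewrite Xzero_neg|exact: le_lt_trans xx'].
case: ifPn => [/set_mem xp|/negP xp].
  move=> /ereal_inf_lt[_ [x' x'n <-]]; rewrite lte_fin => xx'.
  have [||||y yb xy] := @segment_meets_rel_boundary (Xpos eta) x x' => //.
  - by case: x'n.
  - by case: x'n => _ h [_]; rewrite ltNge (ltW h).
  - by exists y; [rewrite Xzero_pos|exact: le_lt_trans xx'].
move=> _; exists x; last by rewrite subrr normr0.
split => //; apply/eqP; rewrite eq_le !leNgt; apply/andP; split; apply/negP => h.
  by apply: xp; rewrite inE.
by apply: xn; rewrite inE.
Qed.

(** The boundary is covered by about [t ^ (1 - d)] balls of radius of order [t]. Enlarged balls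
    cover the near set, and each meets at most about [(t / s) ^ d] cubes; the product is of order
    [t * s ^ (- d)]. *)
Lemma card_cubes_near_boundary : (0 < d)%N -> rectifiable d.-1 (Xzero eta) ->
  exists2 C : R, 0 < C & forall (A : nat -> set E) (J : {fset nat}) (s t : R),
    0 < s -> 0 < t <= 1 -> s <= 3 * t ->
    (forall j, is_cube s (A j)) -> trivIset setT A ->
    (forall j, j \in J -> exists2 x, A j x & near_set eta t x) ->
    (#|` J|)%:R <= C * (t * s^-1 ^+ d).
Proof.
move=> d0 /rectifiable_cover[C C0 HC].
exists (C * (2 * C + 8) ^+ d).
  by rewrite mulr_gt0// exprn_gt0//; lra.
move=> A J s t s0 /[dup] t01 /andP[t0 t1] st cA tA HJ.
have [ys [ysC ysX]] := HC t t01.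
apply: (@le_trans _ _ ((size ys)%:R * ((2 * C + 8) * (t / s)) ^+ d)).
  apply: (@card_fset_cover _ _ _ _ (fun j y => exists2 x, A j x & `|x - y| <= (C + 1) * t)).
    move=> j /HJ[x Ax /(near_set_Xzero _ _ t0)[z /ysX[y yy zy] xz]].
    exists y => //; exists x => //.
    rewrite -(subrKA z); apply: (le_trans (ler_normD _ _)).
    by rewrite mulrDl mul1r; lra.
  move=> y J' _ H.
  apply: (le_trans (@card_cubes_meeting_ball _ _ A J' s ((C + 1) * t) y s0 _ cA tA H)).
    by rewrite mulr_ge0//; lra.
  rewrite lerXn2r ?nnegrE//.
  - by rewrite addr_ge0// !mulr_ge0 ?invr_ge0//; lra.
  - by rewrite !mulr_ge0 ?invr_ge0//; lra.
  (* Here [s <= 3 * t] absorbs the additive 2 of the cube count into a multiple of [t / s]. *)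
  - have : 2 <= 6 * (t / s).
      by rewrite mulrA ler_pdivlMr//; lra.
    by rewrite -!mulrA; lra.
apply: (le_trans (ler_wpM2r _ ysC)).
  by rewrite exprn_ge0// !mulr_ge0 ?invr_ge0//; lra.
have tt : t^-1 ^+ d.-1 * t ^+ d = t.
  rewrite -[in t ^+ d](prednK d0) exprSr mulrA -exprMn mulVf ?gt_eqF//.
  by rewrite expr1n mul1r.
rewrite [leLHS](_ : _ = C * (2 * C + 8) ^+ d * (t^-1 ^+ d.-1 * t ^+ d * s^-1 ^+ d)).
  by rewrite tt.
by rewrite !exprMn; ring.
Qed.

Lemma cube_diam (s : R) (B : set E) x y : 0 <= s -> is_cube s B -> B x -> B y ->
  `|x - y| <= s.
Proof.
move=> s0 [a [bl [br ->]]] Bx By; apply/normr_rV_le => // i; rewrite !mxE.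
have H (z : E) : (forall i, z ord0 i \in Interval (BSide (bl i) (a ord0 i)) (BSide (br i) (a
  ord0 i + s))) ->
    a ord0 i <= z ord0 i <= a ord0 i + s.
  by move=> /(_ i); case: (bl i) (br i) => -[]; rewrite in_itv /= => /andP[? ?]; apply/andP;
    split; lra.
have /andP[? ?] := H _ Bx; have /andP[? ?] := H _ By.
by rewrite ler_norml; apply/andP; split; lra.
Qed.

(** Each point of such a cube is within [s] of both classes. The radius is [2 * s] because
    [near_set] is defined by a strict inequality. *)
Lemma straddling_cube_near (s : R) (B : set E) x x' y : 0 < s -> is_cube s B ->
  B x -> Xpos eta x -> B x' -> Xneg eta x' -> B y -> cubeX y ->
  near_set eta (2 * s) y.
Proof.
move=> s0 cB Bx px Bx' nx' By Xy; split => //; rewrite /Delta.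
have s2 : s < 2 * s by lra.
case: ifPn => _.
  apply: (@le_lt_trans _ _ (`|y - x|)%:E).
    by apply: ereal_inf_lbound; exists x.
  by rewrite lte_fin; apply: le_lt_trans s2; apply: cube_diam cB _ _ => //; exact: ltW.
case: ifPn => _.
  apply: (@le_lt_trans _ _ (`|y - x'|)%:E).
    by apply: ereal_inf_lbound; exists x'.
  by rewrite lte_fin; apply: le_lt_trans s2; apply: cube_diam cB _ _ => //; exact: ltW.
by rewrite lte_fin; lra.
Qed.

End margin_geometry.

(** * Borel measurability *)

Section borel.
Context {R : realType} {d : nat}.
Local Notation E := 'rV[R]_d.

Lemma open_measurable_rV (U : set E) : open U -> measurable U.
Proof. by move=> oU; exact: sub_sigma_algebra. Qed.

Lemma measurable_coord i : measurable_fun setT (fun x : E => x ord0 i).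
Proof.
apply: (measurability _ (RGenOInfty.measurableE R)) => _ [_ [r ->] <-].
rewrite setTI; apply: open_measurable_rV; apply: open_comp; last exact: interval_open.
by move=> x _; exact: coord_continuous.
Qed.

Lemma measurable_forall_coord (B : 'I_d -> set R) : (forall i, measurable (B i)) ->
  measurable [set x : E | forall i, B i (x ord0 i)].
Proof.
move=> mB.
rewrite (_ : mkset _ = \bigcap_(i in setT) ((fun x : E => x ord0 i) @^-1` B i)); last first.
  by apply/seteqP; split => x /= H i; [move=> _|]; exact: H.
apply: fin_bigcap_measurable; first exact: finite_finset.
by move=> i _; rewrite -[X in measurable X]setTI; exact: measurable_coord.
Qed.

Lemma measurable_cube (s : R) (C : set E) : is_cube s C -> measurable C.
Proof.
move=> [a [bl [br ->]]].
by apply: (measurable_forall_coord (fun i =>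
  [set` Interval (BSide (bl i) (a ord0 i)) (BSide (br i) (a ord0 i + s))])).
Qed.

Lemma measurable_cubeX : measurable (@cubeX R d).
Proof.
rewrite (_ : cubeX = [set x : E | forall i, `[-1, 1]%classic (x ord0 i)]).
  exact: (measurable_forall_coord (fun=> `[-1, 1]%classic)).
by apply/seteqP; split => x H i /=; have := H i; rewrite /= in_itv.
Qed.

(** The set is a union of open balls centred in [B], hence open for an arbitrary [B]. *)
Lemma measurable_dist_set_lt (B : set E) (t : R) :
  measurable [set x | (dist_set x B < t%:E)%E].
Proof.
apply: open_measurable_rV.
rewrite (_ : mkset _ = \bigcup_(x' in B) ball x' t).
  apply: bigcup_open => x' _; have [t0|t0] := ltP 0 t; first exact: ball_open.
  rewrite (_ : ball x' t = set0); first exact: open0.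
  apply/seteqP; split => // y; rewrite -ball_normE /ball_ /= ltNge.
  by rewrite (le_trans t0).
apply/seteqP; split => [x /ereal_inf_lt[_ [x' Bx' <-]]|x [x' Bx']].
  by rewrite lte_fin => h; exists x' => //; rewrite -ball_normE /ball_ /= distrC.
rewrite -ball_normE /ball_ /= => h; apply: (@le_lt_trans _ _ (`|x - x'|)%:E).
  by apply: ereal_inf_lbound; exists x'.
by rewrite lte_fin distrC.
Qed.

Lemma measurable_preimage_cubeX (eta : E -> R) (B : set R) :
  measurable_fun cubeX eta -> measurable B -> measurable (cubeX `&` eta @^-1` B).
Proof. by move=> me mB; apply: me => //; exact: measurable_cubeX. Qed.

Lemma measurable_near_set (eta : E -> R) (t : R) : measurable_fun cubeX eta ->
  measurable (near_set eta t).
Proof.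
move=> me.
have mn : measurable (Xneg eta).
  rewrite (_ : Xneg eta = cubeX `&` eta @^-1` `]-oo, 1/2[%classic).
    exact: measurable_preimage_cubeX.
  by apply/seteqP; split => x [Xx]; rewrite /= in_itv.
have mp : measurable (Xpos eta).
  rewrite (_ : Xpos eta = cubeX `&` eta @^-1` `]1/2, +oo[%classic).
    exact: measurable_preimage_cubeX.
  by apply/seteqP; split => x [Xx]; rewrite /= in_itv /= andbT.
have Xnp x : Xneg eta x -> ~ Xpos eta x by move=> [_ h] [_]; rewrite ltNge ltW.
have -> : near_set eta t =
   (Xneg eta `&` [set x | (dist_set x (Xpos eta) < t%:E)%E]) `|`
   (Xpos eta `&` [set x | (dist_set x (Xneg eta) < t%:E)%E]) `|`
   ((cubeX `\` (Xneg eta `|` Xpos eta)) `&` [set _ | 0 < t]).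
  apply/seteqP; split => x.
    move=> [Xx]; rewrite /Delta; case: ifPn => [/set_mem xn h|/negP xn].
      by left; left.
    case: ifPn => [/set_mem xp h|/negP xp]; first by left; right.
    rewrite lte_fin => h; right; split => //; split => // -[h'|h'].
      by apply: xn; rewrite inE.
    by apply: xp; rewrite inE.
  move=> [[[xn h]|[xp h]]|[[Xx /not_orP[xn xp]] h]].
  - by split; [case: xn|rewrite /Delta mem_set].
  - split; [by case: xp|rewrite /Delta memNset ?mem_set// => xn; exact: (Xnp x)].
  - by split => //; rewrite /Delta !memNset.
apply: measurableU; first apply: measurableU.
- by apply: measurableI => //; exact: measurable_dist_set_lt.
- by apply: measurableI => //; exact: measurable_dist_set_lt.
apply: measurableI; last first.
  by have [h|h] := boolP (0 < t);
    [rewrite (_ : mkset _ = setT)//|rewrite (_ : mkset _ = set0)//];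
    apply/seteqP; split => // x _ /=; rewrite ?h//; case: (0 < t) h.
by apply: measurableD; [exact: measurable_cubeX|exact: measurableU].
Qed.

End borel.

(** * Noise and excess risk *)

Section noise.
Context {R : realType} {d : nat}.
Local Notation E := 'rV[R]_d.
Local Notation Z := (E * bool)%type.
Context (P : probability Z R) (eta : E -> R).
Hypothesis P_on_X : P (cubeX `*` setT) = 1%E.
Hypothesis eta_posterior : is_posterior P eta.
Local Notation PX := (marginalX P).

Definition gap (x : E) : R := `|2 * eta x - 1|.

(** The domain is cut down to [cubeX] because [eta] is constrained only there. *)
Definition noise (B : set E) : \bar R := (\int[PX]_(x in B `&` cubeX) (gap x)%:E)%E.

Definition wrong (f : E -> R) : set Z := [set z | z.2 != (0 <= f z.1)].

(** Comparison with the Bayes rule, ties [eta x = 1 / 2] going to label 1 as in [sign]; at a tie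
    [gap] is 0, so the convention does not affect the noise. *)
Definition disagree (f : E -> R) : set E :=
  [set x | cubeX x /\ (0 <= f x) != (1 / 2 <= eta x)].

Let meta : measurable_fun cubeX eta. Proof. by case: eta_posterior. Qed.
Let eta01 x : cubeX x -> 0 <= eta x <= 1. Proof. by case: eta_posterior => _ + _; exact. Qed.
Let mX := @measurable_cubeX R d.

Lemma gap_ge0 x : 0 <= gap x. Proof. exact: normr_ge0. Qed.

Lemma measurable_gap : measurable_fun cubeX (EFin \o gap).
Proof.
apply/measurable_EFinP; apply: measurableT_comp => //.
by apply: measurable_funB => //; exact: measurable_funM.
Qed.

Let mgap (B : set E) : measurable B -> measurable_fun (B `&` cubeX) (EFin \o gap).
Proof.
move=> mB; apply: measurable_funS measurable_gap => //; exact: subIsetr.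
Qed.

Lemma le_noise (B C : set E) : measurable B -> measurable C -> B `<=` C ->
  (noise B <= noise C)%E.
Proof.
move=> mB mC BC; apply: ge0_subset_integral.
- exact: measurableI.
- exact: measurableI.
- exact: mgap.
- by move=> x _; rewrite lee_fin gap_ge0.
- exact: setSI.
Qed.

Lemma noiseU_le (B C : set E) : measurable B -> measurable C ->
  (noise (B `|` C) <= noise B + noise C)%E.
Proof.
move=> mB mC.
have -> : B `|` C = B `|` (C `\` B) by rewrite setDE setUIr setUCr setIT.
rewrite /noise setIUl ge0_integral_setU//.
- apply: leeD2l; apply: le_noise => //; first exact: measurableD.
- exact: measurableI.
- by apply: measurableI => //; exact: measurableD.
- by rewrite -setIUl; apply: mgap; apply: measurableU => //; exact: measurableD.
- by move=> x _; rewrite lee_fin gap_ge0.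
- apply/disj_setPS => x [[Bx _] [[_ nBx] _]].
  exact: nBx.
Qed.

Lemma noise_ge0 B : (0 <= noise B)%E.
Proof. by apply: integral_ge0 => x _; rewrite lee_fin gap_ge0. Qed.

Lemma gap_le1 x : cubeX x -> gap x <= 1.
Proof. by move=> /eta01/andP[? ?]; rewrite /gap ler_norml; apply/andP; split; lra. Qed.

Lemma noise_le_marginal (B : set E) : measurable B -> (noise B <= PX B)%E.
Proof.
move=> mB; rewrite -[leRHS]mul1e -integral_cst//.
apply: (@le_trans _ _ (\int[PX]_(x in B `&` cubeX) (cst 1 x))%E).
  apply: ge0_le_integral => //.
  - exact: measurableI.
  - by move=> x _; rewrite lee_fin gap_ge0.
  - exact: mgap.
  - by move=> x [_ Xx]; rewrite lee_fin gap_le1.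
by apply: ge0_subset_integral => //; exact: measurableI.
Qed.

Lemma noise_fin (B : set E) : measurable B -> noise B \is a fin_num.
Proof.
move=> mB; rewrite ge0_fin_numE ?noise_ge0//.
apply: le_lt_trans (noise_le_marginal _ mB) _.
by rewrite ltey_eq fin_num_measure.
Qed.

Lemma marginal_compl_cubeX (B : set E) : measurable B -> PX B = PX (B `&` cubeX).
Proof.
move=> mB; rewrite -{1}(setUIDK B cubeX) measureU//.
- rewrite [X in (_ + X)%E](_ : _ = 0)%E ?adde0//.
  apply/eqP; rewrite eq_le measure_ge0 andbT.
  apply: (@le_trans _ _ (PX (~` cubeX))).
    by apply: le_measure; rewrite ?inE//; [exact: measurableD|exact: measurableC].
  rewrite probability_setC// (_ : PX cubeX = 1%E) ?subee//.
  by rewrite -P_on_X /marginalX /distribution /pushforward; congr (P _); apply/seteqP;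
    split => z //= [].
- exact: measurableI.
- exact: measurableD.
- by apply/seteqP; split => // x [[_ h] [_ /(_ h)]].
Qed.

Lemma prob_true (B : set E) : measurable B -> B `<=` cubeX ->
  P (B `*` [set true]) = (\int[PX]_(x in B) (eta x)%:E)%E.
Proof. by case: eta_posterior => _ _; exact. Qed.

Let mS (B : set E) (b : bool) : measurable B -> measurable (B `*` [set b]).
Proof. by move=> mB; exact: measurableX. Qed.

Let meta_sub (B : set E) : measurable B -> B `<=` cubeX -> measurable_fun B eta.
Proof. by move=> mB BX; exact: measurable_funS meta. Qed.

Lemma prob_false (B : set E) : measurable B -> B `<=` cubeX ->
  P (B `*` [set false]) = (\int[PX]_(x in B) (1 - eta x)%:E)%E.
Proof.
move=> mB BX.
have PB : PX B = (P (B `*` [set false]) + P (B `*` [set true]))%E.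
  rewrite -measureU; [|exact: mS|exact: mS|by apply/seteqP; split => // -[x b] [[_ /= ->] []]].
  rewrite /marginalX /distribution /pushforward; congr (P _).
  by apply/seteqP; split => -[x []]//=; [right|left|case=> -[]|case => -[]].
have fin b : P (B `*` [set b]) \is a fin_num by rewrite fin_num_measure//; exact: mS.
have I1 : (\int[PX]_(x in B) (1 - eta x)%:E + \int[PX]_(x in B) (eta x)%:E = PX B)%E.
  rewrite -ge0_integralD//.
  - under eq_integral do rewrite -EFinD subrK.
    by rewrite (integral_cst _ mB) mul1e.
  - by move=> x /BX /eta01/andP[? ?]; rewrite lee_fin; lra.
  - by apply/measurable_EFinP; apply: measurable_funB => //; exact: meta_sub.
  - by move=> x /BX /eta01/andP[? ?]; rewrite lee_fin; lra.
  - by apply/measurable_EFinP; exact: meta_sub.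
move: I1; rewrite -prob_true// PB => /esym.
move: (fin false) (fin true); case: (P (_ `*` [set false])) => // a _; case: (P _) => // b _.
case: (\int[_]_(_ in _) _)%E => //= c; rewrite -!EFinD => -[] /addIr -> //.
Qed.

Lemma disagree_measurable (f : E -> R) : measurable_fun cubeX f -> measurable (disagree f).
Proof.
move=> mf.
have mF : measurable (cubeX `&` f @^-1` `[0, +oo[%classic) by exact: measurable_preimage_cubeX.
have mG : measurable (cubeX `&` eta @^-1` `[1/2, +oo[%classic) by exact:
  measurable_preimage_cubeX.
move: (measurableU _ _ (measurableD mF mG) (measurableD mG mF)).
congr (measurable _); apply/seteqP; split => x /=; rewrite /disagree /= !in_itv /= !andbT.
  by move=> [[[Xx ->]]|[[Xx ->]]] /not_andP[]// /negP/negbTE ->.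
move=> [Xx]; case: (0 <= f x); case: (1/2 <= eta x) => // _; [left|right]; split => //.
  by case.
by case.
Qed.

(** The Bayes risk: [(1 - gap x) / 2] is the minimum of [eta x] and [1 - eta x]. *)
Definition base_risk : \bar R := (\int[PX]_(x in cubeX) ((1 - gap x) / 2)%:E)%E.

Lemma prob_wrong (f : E -> R) : measurable_fun cubeX f ->
  P (wrong f `&` (cubeX `*` setT)) = (base_risk + noise (disagree f))%E.
Proof.
move=> mf.
pose F1 := cubeX `&` f @^-1` `]-oo, 0[%classic.
pose F2 := cubeX `&` f @^-1` `[0, +oo[%classic.
have mF1 : measurable F1 by exact: measurable_preimage_cubeX.
have mF2 : measurable F2 by exact: measurable_preimage_cubeX.
have -> : wrong f `&` (cubeX `*` setT) = (F1 `*` [set true]) `|` (F2 `*` [set false]).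
  apply/seteqP; split => -[x b] /=; rewrite /wrong /F1 /F2 /= !in_itv /= andbT ltNge.
    by move=> [h [Xx _]]; case: b h; [left|right]; split => //; split => //; case: (0 <= f x) h.
  by move=> [[[Xx h] ->]|[[Xx h] ->]]; split => //; rewrite ?h//; case: (0 <= f x) h.
have -> : P (F1 `*` [set true] `|` F2 `*` [set false]) =
    (P (F1 `*` [set true]) + P (F2 `*` [set false]))%E.
  apply: measureU; [exact: mS|exact: mS|].
  by apply/seteqP; split => // -[x b] [[_ /= ->] []].
have F1X : F1 `<=` cubeX by exact: subIsetl.
have F2X : F2 `<=` cubeX by exact: subIsetl.
rewrite prob_true// prob_false//.
(* The conditional error probability of [f]: the unavoidable error, plus the gap where [f] departs
   from the Bayes rule. This one formula serves on both halves [F1] and [F2]. *)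
pose g x := (1 - gap x) / 2 + gap x * \1_(disagree f) x.
have g1 x : F1 x -> eta x = g x.
  rewrite /F1 /= in_itv /= ltNge => -[Xx h]; rewrite /g indicE /gap.
  have [xd|xd] := boolP (x \in disagree f); rewrite ?mulr1 ?mulr0.
    move: xd; rewrite inE => -[_]; rewrite (negbTE h); case: (leP (1/2) (eta x)) => // ? _.
    by rewrite ger0_norm; lra.
  case: (leP (1/2) (eta x)) => e; last by rewrite ltr0_norm; lra.
  by case/negP: xd; rewrite inE; split => //; rewrite (negbTE h) e.
have g2 x : F2 x -> 1 - eta x = g x.
  rewrite /F2 /= in_itv /= andbT => -[Xx h]; rewrite /g indicE /gap.
  have [xd|xd] := boolP (x \in disagree f); rewrite ?mulr1 ?mulr0.
    move: xd; rewrite inE => -[_]; rewrite h; case: (leP (1/2) (eta x)) => // ? _.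
    by rewrite ltr0_norm; lra.
  case: (leP (1/2) (eta x)) => e; first by rewrite ger0_norm; lra.
  by case/negP: xd; rewrite inE; split => //; rewrite h leNgt e.
have -> : (\int[PX]_(x in F1) (eta x)%:E = \int[PX]_(x in F1) (g x)%:E)%E.
  by apply: eq_integral => x /set_mem /g1 ->.
have -> : (\int[PX]_(x in F2) (1 - eta x)%:E = \int[PX]_(x in F2) (g x)%:E)%E.
  by apply: eq_integral => x /set_mem /g2 ->.
have md := disagree_measurable f mf.
have FX : F1 `|` F2 = cubeX.
  rewrite /F1 /F2 -setIUr; apply/seteqP; split => x; first by case.
  by move=> Xx; split => //; rewrite /= !in_itv /= andbT; case: (ltP (f x) 0); [left|right].
have mg1 : measurable_fun cubeX (fun x => (1 - gap x) / 2).
  apply: measurable_funM => //; apply: measurable_funB => //.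
  by apply/measurable_EFinP; exact: measurable_gap.
have mg2 : measurable_fun cubeX (fun x => gap x * \1_(disagree f) x).
  apply: measurable_funM; first by apply/measurable_EFinP; exact: measurable_gap.
  exact: measurable_indic.
have g1p x : cubeX x -> 0 <= (1 - gap x) / 2.
  by move=> /gap_le1 h; apply: divr_ge0 => //; lra.
have g2p x : 0 <= gap x * \1_(disagree f) x by rewrite mulr_ge0// gap_ge0.
rewrite -ge0_integral_setU//; last first.
- by apply/disj_setPS => x [[_ /=] + [_ /=]]; rewrite !in_itv /= andbT ltNge => /negP.
- by rewrite FX => x Xx; rewrite lee_fin /g addr_ge0// g1p.
- by rewrite FX; apply/measurable_EFinP; exact: measurable_funD.
rewrite FX; under eq_integral do rewrite EFinD.
rewrite ge0_integralD//; first last.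
- exact/measurable_EFinP.
- by move=> x _; rewrite lee_fin.
- exact/measurable_EFinP.
congr (_ + _)%E.
rewrite /noise setIC integral_mkcondr; apply: eq_integral => x _.
by rewrite patchE indicE; case: (x \in _); rewrite ?mulr1 ?mulr0.
Qed.
End noise.

(** * Excess risk and the comparison of mass with noise *)

Section excess_risk.
Context {R : realType} {d : nat}.
Local Notation E := 'rV[R]_d.
Local Notation Z := (E * bool)%type.
Context (P : probability Z R) (eta : E -> R).
Hypothesis P_on_X : P (cubeX `*` setT) = 1%E.
Hypothesis eta_posterior : is_posterior P eta.
Local Notation PX := (marginalX P).
Local Notation noise := (noise P eta).
Local Notation disagree := (disagree eta).
Local Notation base_risk := (base_risk P eta).
Local Notation wrong := (@wrong R d).

Let meta : measurable_fun cubeX eta. Proof. by case: eta_posterior. Qed.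
Let mX := @measurable_cubeX R d.

Let mdis f (mf : measurable_fun cubeX f) : measurable (disagree f) :=
  disagree_measurable P eta eta_posterior f mf.

Definition pX (B : set E) : R := fine (PX B).
Definition nu (B : set E) : R := fine (noise B).

Lemma loss_wrong (f : E -> R) (z : Z) : loss z.2 (f z.1) = \1_(wrong f) z :> R.
Proof.
rewrite /loss !indicE; congr (_ %:R); congr nat_of_bool.
apply/idP/idP; rewrite !inE /wrong /= in_itv /= /label /sign;
  case: (z.2); case: (leP 0 (f z.1)) => //= _;
    rewrite ?mulr1 ?mul1r ?mulN1r ?opprK ?ler10 ?lerN10//.
Qed.

Lemma measurable_wrong_cubeX (f : E -> R) : measurable_fun cubeX f ->
  measurable (wrong f `&` (cubeX `*` setT)).
Proof.
move=> mf.
have mF1 : measurable (cubeX `&` f @^-1` `]-oo, 0[%classic) by exact: measurable_preimage_cubeX.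
have mF2 : measurable (cubeX `&` f @^-1` `[0, +oo[%classic) by exact: measurable_preimage_cubeX.
have mb (b : bool) : measurable [set b] by [].
move: (measurableU _ _ (measurableX mF1 (mb true)) (measurableX mF2 (mb false))).
congr (measurable _).
apply/seteqP; split => -[x b] /=; rewrite /wrong /= !in_itv /= andbT ltNge.
  by move=> [[[Xx h] ->]|[[Xx h] ->]]; split => //; rewrite ?h//; case: (0 <= f x) h.
by move=> [h [Xx _]]; case: b h; [left|right]; split => //; split => //; case: (0 <= f x) h.
Qed.

(** A constant classifier suffices: its error probability is finite and equals [base_risk] plus a
    nonnegative noise. *)
Lemma base_risk_fin : base_risk \is a fin_num.
Proof.
have : (0 <= base_risk)%E.
  apply: integral_ge0 => x Xx; rewrite lee_fin divr_ge0// subr_ge0.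
  exact: (gap_le1 P).
have mz : measurable_fun cubeX (cst 0 : E -> R) by [].
have := prob_wrong P eta eta_posterior (cst 0) mz.
have : P (wrong (cst 0) `&` cubeX `*` setT) \is a fin_num.
  by rewrite fin_num_measure//; exact: measurable_wrong_cubeX.
have := noise_ge0 P eta (disagree (cst 0)).
case: (noise _) => //= [r|]; case: (base_risk) => //= ?; by case: (P _).
Qed.

Lemma risk_wrong (f : E -> R) : measurable_fun cubeX f ->
  risk P f = (base_risk + noise (disagree f))%E.
Proof.
move=> mf; rewrite -(prob_wrong P eta eta_posterior f mf) /risk.
have mXT : measurable (@cubeX R d `*` @setT bool) by exact: measurableX.
transitivity (\int[P]_(z in cubeX `*` setT) (\1_(wrong f `&` (cubeX `*` setT)) z)%:E)%E.
  apply: eq_integral => z /set_mem zX; rewrite loss_wrong !indicE in_setI.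
  by rewrite (mem_set zX) andbT.
rewrite integral_indic//; last exact: measurable_wrong_cubeX.
by rewrite -setIA setIid.
Qed.

Lemma bayes_riskE : bayes_risk P = base_risk.
Proof.
apply/eqP; rewrite eq_le; apply/andP; split; last first.
  apply: le_ereal_inf_tmp => _ [f /= mf <-]; rewrite risk_wrong//.
  by rewrite leeDl// noise_ge0.
(* The infimum is attained by the Bayes rule, whose disagreement set is empty. *)
apply: ereal_inf_lbound; exists (fun x => eta x - 1 / 2) => /=.
  exact: measurable_funB.
rewrite risk_wrong; last exact: measurable_funB.
rewrite (_ : disagree _ = set0) ?/noise ?set0I ?integral_set0 ?adde0//.
by apply/seteqP; split => x //= [_]; rewrite subr_ge0 eqxx.
Qed.

Lemma risk_excess (f : E -> R) : measurable_fun cubeX f ->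
  (risk P f - bayes_risk P = (nu (disagree f))%:E)%E.
Proof.
move=> mf; rewrite bayes_riskE risk_wrong// addeC addeA.
rewrite /nu fineK ?noise_fin//; last exact: mdis.
by rewrite [(- _ + _)%E]addeC subee ?base_risk_fin// add0e.
Qed.

Lemma wrong_measurable (f : E -> R) : measurable_fun setT f -> measurable (wrong f).
Proof.
move=> mf.
have mF1 : measurable (f @^-1` `]-oo, 0[%classic) by rewrite -[X in measurable X]setTI;
  exact: mf.
have mF2 : measurable (f @^-1` `[0, +oo[%classic) by rewrite -[X in measurable X]setTI;
  exact: mf.
have mb (b : bool) : measurable [set b] by [].
move: (measurableU _ _ (measurableX mF1 (mb true)) (measurableX mF2 (mb false))).
congr (measurable _).
apply/seteqP; split => -[x b] /=; rewrite /wrong /= !in_itv /= andbT ltNge.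
  by move=> [[h ->]|[h ->]]; rewrite ?h//; case: (0 <= f x) h.
by move=> h; case: b h; [left|right]; split => //; case: (0 <= f x) h.
Qed.

Lemma prob_on_cubeX (B : set Z) : measurable B -> P B = P (B `&` (cubeX `*` setT)).
Proof.
move=> mB.
have mXT : measurable (@cubeX R d `*` @setT bool) by exact: measurableX.
rewrite (measureDI P mB mXT).
rewrite [X in (X + _)%E](_ : _ = 0)%E ?add0e//.
apply/eqP; rewrite eq_le measure_ge0 andbT.
apply: (@le_trans _ _ (P (~` (cubeX `*` setT)))).
  by apply: le_measure; rewrite ?inE//; [exact: measurableD|exact: measurableC].
by rewrite probability_setC// P_on_X subee.
Qed.

Lemma fine_prob_wrong (f : E -> R) : measurable_fun setT f ->
  fine (P (wrong f)) = fine base_risk + nu (disagree f).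
Proof.
move=> mf; have mfX : measurable_fun cubeX f by exact: measurable_funTS.
rewrite prob_on_cubeX; last exact: wrong_measurable.
rewrite (prob_wrong P eta eta_posterior)// fineD ?base_risk_fin ?noise_fin//.
exact: mdis.
Qed.

(** Where exactly one of [f] and [g] errs, their predictions differ, so one of them departs from the
    Bayes rule. This controls the variance of their loss difference. *)
Lemma prob_wrongD_le (f g : E -> R) : measurable_fun setT f -> measurable_fun setT g ->
  fine (P (wrong f `\` wrong g)) + fine (P (wrong g `\` wrong f)) <=
  pX (disagree f) + pX (disagree g).
Proof.
move=> mf mg; have mwf := wrong_measurable f mf; have mwg := wrong_measurable g mg.
have mB := measurableD mwf mwg; have mC := measurableD mwg mwf.
have mdf : measurable (disagree f) by apply: mdis => //; exact: measurable_funTS.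
have mdg : measurable (disagree g) by apply: mdis => //; exact: measurable_funTS.
rewrite /pX -!fineD ?fin_num_measure//; apply: fine_le; rewrite ?fin_numD ?fin_num_measure//.
have BC0 : (wrong f `\` wrong g) `&` (wrong g `\` wrong f) = set0.
  by apply/seteqP; split => z // [[? ?] []].
apply: (@le_trans _ _ (P ((wrong f `\` wrong g) `|` (wrong g `\` wrong f)))).
  by rewrite measureU.
apply: (le_trans _ (measureU2 PX mdf mdg)).
rewrite prob_on_cubeX; last exact: measurableU.
rewrite /marginalX /distribution /pushforward; apply: le_measure; rewrite ?inE.
- by apply: measurableI; [exact: measurableU|exact: measurableX].
- by rewrite -[X in measurable X]setTI; apply: measurable_fst => //; exact: measurableU.
move=> [x b] [] + [/= Xx _]; rewrite /wrong /disagree /= => H.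
have : (0 <= f x) != (0 <= g x).
  by case: H => -[]; case: (0 <= f x); case: (0 <= g x); case: b.
case: (0 <= f x); case: (0 <= g x) => // _; case: (1/2 <= eta x); by [left|right].
Qed.

Lemma le_nu (B C : set E) : measurable B -> measurable C -> B `<=` C -> nu B <= nu C.
Proof. by move=> mB mC BC; apply: fine_le; rewrite ?noise_fin//; exact: le_noise. Qed.

Lemma nuU_le (B C : set E) : measurable B -> measurable C ->
  nu (B `|` C) <= nu B + nu C.
Proof.
move=> mB mC; rewrite /nu -fineD ?noise_fin//; apply: fine_le.
- by rewrite noise_fin//; exact: measurableU.
- by rewrite fin_numD !noise_fin.
- exact: noiseU_le.
Qed.

Lemma nu_ge0 (B : set E) : 0 <= nu B.
Proof. by apply: fine_ge0; exact: noise_ge0. Qed.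

Lemma pX_ge0 (B : set E) : 0 <= pX B.
Proof. exact: fine_ge0. Qed.

Lemma pX_set0 : pX set0 = 0.
Proof. by rewrite /pX measure0. Qed.

Lemma nu_le_pX (B : set E) : measurable B -> nu B <= pX B.
Proof.
move=> mB; apply: fine_le; rewrite ?noise_fin ?fin_num_measure//.
exact: noise_le_marginal.
Qed.

(** Off the near set the distance is at least [t], so the noise control gives
    [1 <= c * t ^ (- gamma) * gap] almost everywhere; integrating this bounds mass by noise. It
    plays the role of a variance bound, up to the mass of the near set. *)
Lemma marginal_le_near (gamma : R) : 0 <= gamma -> controls_noise_below P eta gamma ->
  exists2 c : R, 0 < c & forall (t : R) (B : set E), 0 < t -> measurable B ->
  pX B <= pX (B `&` near_set eta t) + c * t `^ (- gamma) * nu B.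
Proof.
move=> g0 [c c0 [N [mN N0 HN]]]; exists c => // t B t0 mB.
have mnear := measurable_near_set eta t meta.
(* Removing the null set [N] makes the noise control hold at every point of [K]. *)
pose K := ((B `\` near_set eta t) `&` cubeX) `\` N.
have mK : measurable K.
  by apply: measurableD => //; apply: measurableI => //; exact: measurableD.
have tg : 0 <= c * t `^ (- gamma) by rewrite mulr_ge0 ?powR_ge0// ltW.
have KB : (PX K <= (c * t `^ (- gamma))%:E * noise B)%E.
  rewrite -[leLHS]mul1e -integral_cst//.
  rewrite -ge0_integralZl//; first last.
  - by move=> x _; rewrite lee_fin gap_ge0.
  - apply: measurable_funS (measurable_gap P eta eta_posterior) => //; exact: subIsetr.
  - exact: measurableI.
  have mcg (D : set E) : measurable D -> D `<=` cubeX -> measurable_fun D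
      (fun x => ((c * t `^ (- gamma))%:E * (gap eta x)%:E)%E).
    move=> mD DX; apply: emeasurable_funM => //.
    exact: measurable_funS (measurable_gap P eta eta_posterior).
  apply: (@le_trans _ _ (\int[PX]_(x in K) ((c * t `^ (- gamma))%:E * (gap eta x)%:E))%E).
    apply: ge0_le_integral => //.
    - by apply: mcg => // x [[]].
    - move=> x [[[Bx nx] Xx] NNx].
      have : (Delta eta x `^ gamma <= (c * `|2 * eta x - 1|)%:E)%E.
        by apply: contrapT => h; apply: NNx; apply: HN => /= /(_ Xx).
      have tD : (t%:E <= Delta eta x)%E.
        by rewrite leNgt; apply/negP => h; apply: nx.
      move=> H.
      have : ((t `^ gamma)%:E <= (c * `|2 * eta x - 1|)%:E)%E.
        apply: le_trans H; rewrite -poweR_EFin; apply: gt0_ler_poweR => //.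
        - by rewrite in_itv /= lee_fin (ltW t0) leey.
        - by rewrite in_itv /= leey andbT (le_trans _ tD)// lee_fin ltW.
      rewrite !lee_fin -/(gap eta x) => h.
      rewrite powRN mulrAC ler_pdivlMr ?powR_gt0// mul1r//.
  apply: ge0_subset_integral => //.
  - exact: measurableI.
  - apply: mcg; [exact: measurableI|exact: subIsetr].
  - by move=> x _; rewrite -EFinM lee_fin mulr_ge0 ?gap_ge0.
  - by move=> x [[[]]].
rewrite /pX /nu -[c * _]/(fine (c * t `^ (- gamma))%:E) -fineM ?noise_fin// -fineD;
  last 2 first.
- by rewrite fin_num_measure//; exact: measurableI.
- by rewrite fin_numM// noise_fin.
apply: fine_le.
- by rewrite fin_num_measure.
- rewrite fin_numD fin_num_measure/=; last exact: measurableI.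
  by rewrite fin_numM// noise_fin.
apply: (@le_trans _ _ (PX (B `&` near_set eta t) + PX K)%E); last exact: leeD2l.
rewrite (marginal_compl_cubeX P P_on_X)//.
apply: (@le_trans _ _ (PX ((B `&` near_set eta t `|` K) `|` N))).
  apply: le_measure; rewrite ?inE.
  - exact: measurableI.
  - by apply: measurableU => //; apply: measurableU => //; exact: measurableI.
  - move=> x [Bx Xx]; have [Nx|Nx] := pselect (N x); first by right.
    by left; have [h|h] := pselect (near_set eta t x); [left|right].
apply: (le_trans (measureU2 _ _ _)) => //.
  by apply: measurableU => //; exact: measurableI.
rewrite [X in (_ + X)%E](_ : _ = 0)%E ?adde0//.
by apply: measureU2 => //; exact: measurableI.
Qed.
End excess_risk.

(** * Histogram rules *)

Section histogram.
Context {R : realType} {d : nat}.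
Local Notation E := 'rV[R]_d.
Local Notation Z := (E * bool)%type.
Implicit Types (A : nat -> set E) (D : seq Z).

(** The signed vote in the cell of [x], that is [hist_fun] without the factor [1 / n], which does
    not affect the sign. *)
Definition cell_sum A D (x : E) : R := \sum_(z <- D) label z.2 * \1_(cell A x) z.1.

Lemma hist_ge0 A D x : (0 <= hist A D x) = (0 <= cell_sum A D x).
Proof.
have -> : (0 <= hist A D x) = (0 <= hist_fun A D x).
  by rewrite /hist /sign; case: (leP 0 (hist_fun A D x)) => _; rewrite ?ler01// oppr_ge0 ler10.
have -> : hist_fun A D x = (size D)%:R^-1 * cell_sum A D x.
  rewrite /hist_fun /cell_sum -mulrBr -sumrB; congr (_ * _); apply: eq_bigr => z _.
  by case: (z.2); rewrite /label /= !(mul1r, mul0r, subr0, sub0r, mulN1r).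
have [/size0nil ->|nz] := eqVneq (size D) 0%N.
  by rewrite /cell_sum big_nil mulr0.
by rewrite pmulr_rge0// invr_gt0 ltr0n lt0n.
Qed.

Lemma cellE A j x : trivIset setT A -> A j x -> cell A x = A j.
Proof.
move=> tA Ajx; apply/seteqP; split => [y [i Aix Aiy]|y Ajy]; last by exists j.
by rewrite (tA j i I I)//; exists x.
Qed.

Lemma cell_sumE A D j x : trivIset setT A -> A j x ->
  cell_sum A D x = \sum_(z <- D) (\1_(A j `*` [set true]) z - \1_(A j `*` [set false]) z).
Proof.
move=> tA Ajx; rewrite /cell_sum (cellE A j x tA Ajx); apply: eq_bigr => -[y b] _.
rewrite !indicE !in_setX /=; case: b; rewrite /label.
  by rewrite (@mem_set _ [set true] true)// (@memNset _ [set false] true)// andbF andbT subr0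
    mul1r.
by rewrite (@memNset _ [set true] false)// (@mem_set _ [set false] false)// andbF andbT sub0r
  mulN1r.
Qed.

Lemma measurable_cell A x : (forall j, measurable (A j)) ->
  measurable [set y | cell A y x].
Proof.
move=> mA.
rewrite (_ : mkset _ = \bigcup_(j in [set j | A j x]) A j).
  by apply: bigcup_measurable => j _.
by apply/seteqP; split => y [j ? ?]; exists j.
Qed.

Lemma measurable_hist A D : (forall j, measurable (A j)) ->
  measurable_fun setT (hist A D).
Proof.
move=> mA.
have mS : measurable_fun setT (cell_sum A D).
  apply: measurable_sum => z; apply: measurable_funM => //.
  rewrite (_ : (fun x => _) = (\1_[set y | cell A y z.1] : E -> R)).
    by apply: measurable_indic; exact: measurable_cell.
  by apply/funext => x; rewrite !indicE; congr (_ %:R); congr nat_of_bool; apply/idP/idP;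
    rewrite !inE.
rewrite (_ : hist A D = (fun x => 2 * \1_(cell_sum A D @^-1` `[0, +oo[%classic) x - 1)).
  apply: measurable_funB => //; apply: measurable_funM => //.
  by apply: measurable_indic; rewrite -[X in measurable X]setTI; exact: mS.
apply/funext => x; have := hist_ge0 A D x; rewrite indicE.
case: (leP 0 (cell_sum A D x)) => h H.
  rewrite mem_set; last by rewrite /= in_itv /= h.
  by move: H; rewrite /hist /sign; case: ifP => _ ; [move=> _ /=; lra|rewrite oppr_ge0 ler10].
rewrite memNset; last by rewrite /= in_itv /= andbT leNgt h.
by move: H; rewrite /hist /sign; case: ifP => _ ; [rewrite ler01|move=> _ /=; lra].
Qed.

(** Joint measurability in the sample and the test point is what makes the error probability of a
    histogram a measurable function of the sample. *)
Lemma measurable_wrong_hist A n k : (forall j, measurable (A j)) ->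
  measurable [set p : n.-tuple Z * Z | wrong (hist A (take k p.1)) p.2].
Proof.
move=> mA.
pose S (p : n.-tuple Z * Z) : R := cell_sum A (take k p.1) p.2.1.
have mx (B : set E) : measurable B -> measurable [set p : n.-tuple Z * Z | B p.2.1].
  move=> mB; rewrite -[X in measurable X]setTI.
  exact: (measurableT_comp measurable_fst measurable_snd).
have mi i : measurable_fun setT (fun p : n.-tuple Z * Z => tnth p.1 i).
  by apply: (measurableT_comp (measurable_tnth i) measurable_fst).
have mxi i (B : set E) : measurable B -> measurable [set p : n.-tuple Z * Z | B (tnth p.1 i).1].
  move=> mB; rewrite -[X in measurable X]setTI.
  exact: (measurableT_comp measurable_fst (mi i)).
have mb (b : bool) : measurable [set p : n.-tuple Z * Z | p.2.2 = b].
  have mbf : measurable_fun setT (fun p : n.-tuple Z * Z => p.2.2).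
    exact: (measurableT_comp measurable_snd measurable_snd).
  by rewrite -[X in measurable X]setTI; exact: (mbf measurableT [set b]).
have mS : measurable_fun setT S.
  rewrite /S /cell_sum; under eq_fun do rewrite sum_take_ord big_mkcond.
  apply: measurable_sum => i; case: (i < k)%N => //.
  apply: measurable_funM.
    apply: (measurableT_comp (f := @label R)) => //.
    exact: (measurableT_comp measurable_snd (mi i)).
  (* Two moving points share a cell exactly when both lie in some [A j], which is a countable union
     of measurable events. *)
  rewrite (_ : (fun p => _) = (\1_(\bigcup_j ([set p : n.-tuple Z * Z | A j p.2.1] `&` [set p
    : n.-tuple Z * Z | A j (tnth p.1 i).1])) : _ -> R)).
    apply: measurable_indic; apply: bigcup_measurable => j _.
    by apply: measurableI; [exact: mx|exact: mxi].
  apply/funext => p; rewrite !indicE; congr (_ %:R); congr nat_of_bool.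
  by apply/idP/idP; rewrite !inE => -[j]; [exists j|move=> _ []; exists j].
have mS0 : measurable (S @^-1` `[0, +oo[%classic) by rewrite -[X in measurable X]setTI;
  exact: mS.
have := measurableU _ _ (measurableI _ _ mS0 (mb false)) (measurableI _ _ (measurableC mS0)
  (mb true)).
congr (measurable _); apply/seteqP; split => -[D [x b]] /=;
  rewrite /wrong /S /= hist_ge0 in_itv /= andbT.
  by move=> [[-> ->]//|[/negP/negbTE -> ->]].
by case: b; case: (0 <= _) => // _; [right|left].
Qed.

End histogram.

(** * Validation error *)

Section validation.
Context {R : realType} {d : nat}.
Local Notation E := 'rV[R]_d.
Local Notation Z := (E * bool)%type.
Context (P : probability Z R) (eta : E -> R).
Hypothesis P_on_X : P (cubeX `*` setT) = 1%E.
Hypothesis eta_posterior : is_posterior P eta.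
Local Notation pX := (pX P).
Local Notation nu := (nu P eta).
Local Notation disagree := (disagree eta).

Definition excess_hist (A : nat -> set E) (D : seq Z) : R := nu (disagree (hist A D)).

Lemma measurable_excess_hist A n k : (forall j, measurable (A j)) ->
  measurable_fun setT (fun D : n.-tuple Z => excess_hist A (take k D)).
Proof.
move=> mA.
rewrite (_ : (fun D => _) = (fun D : n.-tuple Z =>
   fine (P (wrong (hist A (take k D)))) - fine (base_risk P eta))).
  apply: measurable_funB => //; apply: measurableT_comp => //.
  have := measurable_fun_xsection P (measurable_wrong_hist A n k mA).
  congr (measurable_fun _ _); apply/funext => D /=; congr (P _).
  by apply/seteqP; split => z; rewrite /xsection /= inE.
apply/funext => D; rewrite (fine_prob_wrong P eta)//.
  by rewrite addrAC subrr add0r.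
exact: measurable_hist.
Qed.

Lemma measurable_excess_hist_gt A n k (f : n.-tuple Z -> R) :
  (forall j, measurable (A j)) -> measurable_fun setT f ->
  measurable [set D : n.-tuple Z | f D < excess_hist A (take k D)].
Proof.
move=> mA mf.
rewrite (_ : mkset _ = ~` [set D : n.-tuple Z | excess_hist A (take k D) <= f D]).
  apply: measurableC; rewrite -[X in measurable X]setTI.
  by apply: measurable_fun_le => //; exact: measurable_excess_hist.
by apply/seteqP; split => D /=; [rewrite ltNge => /negP|move=> /negP; rewrite -ltNge].
Qed.

(** The event that [A] wins or ties against [A0] in validation although its excess risk is much
    larger. The factor 4 leaves enough of the difference of the excess risks to pay for the
    variance. *)
Definition bad_selection (A A0 : nat -> set E) (th : R) k (D : seq Z) : Prop :=
  4 * excess_hist A0 (take k D) + th < excess_hist A (take k D) /\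
  \sum_(z <- drop k D)
    (\1_(wrong (hist A (take k D))) z - \1_(wrong (hist A0 (take k D))) z : R) <= 0.

Lemma measurable_bad_selection A A0 th n k :
  (forall j, measurable (A j)) -> (forall j, measurable (A0 j)) ->
  measurable [set D : n.-tuple Z | bad_selection A A0 th k D].
Proof.
move=> mA mA0; apply: measurableI.
  apply: measurable_excess_hist_gt => //; apply: measurable_funD => //.
  by apply: measurable_funM => //; exact: measurable_excess_hist.
have mw (B : nat -> set E) i : (forall j, measurable (B j)) ->
    measurable_fun setT (fun D : n.-tuple Z => (\1_(wrong (hist B (take k D))) (tnth D i) : R)).
  move=> mB.
  rewrite (_ : (fun D => _) = (\1_((fun D : n.-tuple Z => (D, tnth D i)) @^-1`
      [set p : n.-tuple Z * Z | wrong (hist B (take k p.1)) p.2]) : _ -> R)).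
    apply: measurable_indic; rewrite -[X in measurable X]setTI.
    apply: (measurable_fun_pair _ (measurable_tnth i)) => //.
    exact: measurable_wrong_hist.
  by apply/funext => D; rewrite !indicE; congr (_ %:R); congr nat_of_bool; apply/idP/idP;
    rewrite !inE.
rewrite -[X in measurable X]setTI; apply: measurable_fun_le => //.
under eq_fun do rewrite sum_drop_ord big_mkcond.
apply: measurable_sum => i; case: (i < k)%N => //=.
by apply: measurable_funB; exact: mw.
Qed.

(** With the training part frozen, the loss difference has mean [e - e0] and second moment at most
    [2 * a + b * (e + e0)]. On a bad selection the mean dominates [a / b] and [e0], so a tilt of
    order [1 / b] gives an exponential bound. *)
Lemma prob_bad_selection A A0 n k (a b l : R) : (k <= n)%N ->
  (forall j, measurable (A j)) -> (forall j, measurable (A0 j)) ->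
  0 <= a -> 1 <= b -> 0 <= l ->
  (forall B, measurable B -> pX B <= a + b * nu B) ->
  (prob_pow P n [set D : n.-tuple Z | bad_selection A A0 (4 * a / b + l) k D]
     <= (expR (- ((n - k)%:R * l / (32 * b))))%:E)%E.
Proof.
move=> kn mA mA0 a0 b1 l0 Hab.
have b0 : 0 < b by lra.
apply: (prob_pow_le_prefix P n k (bad_selection A A0 (4 * a / b + l) k)) => //.
  exact: measurable_bad_selection.
move=> u uk; rewrite /bad_selection.
set e := excess_hist A u; set e0 := excess_hist A0 u.
have [ee0|ee0] := leP e (4 * e0 + (4 * a / b + l)).
  rewrite (_ : mkset _ = set0) ?measure0 ?lee_fin ?expR_ge0//.
  apply/seteqP; split => // D /= []; rewrite !take_size_cat// -/e -/e0.
  by rewrite ltNge ee0.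
set W := wrong (hist A u); set W0 := wrong (hist A0 u).
rewrite (_ : mkset _ = [set D : (n - k).-tuple Z |
    (\sum_(z <- take (n - k) D) (\1_W z - \1_W0 z : R) <= 0)%R]); last first.
  apply/seteqP; split => D /=; rewrite !take_size_cat// drop_size_cat//.
    by move=> [_]; rewrite take_oversize// size_tuple.
  by move=> H; split => //; move: H; rewrite take_oversize// size_tuple.
have mh : measurable_fun setT (hist A u) by exact: measurable_hist.
have mh0 : measurable_fun setT (hist A0 u) by exact: measurable_hist.
(* This tilt turns the quadratic term into [(8 * b)^-1] times at most [a / (2 * b) + (e + e0) / 4],
   which the linear term outweighs; [1 <= b] keeps the tilt below 1/2. *)
have l8 : 0 <= (8 * b)^-1 <= 2^-1.
  rewrite invr_ge0 mulr_ge0 ?(ltW b0)//= lef_pV2 ?posrE//; lra.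
apply: (le_trans (prob_pow_indic_sum_le0 P (n - k) (n - k) W W0 (8 * b)^-1 _ _ _ l8)) => //.
- exact: wrong_measurable.
- exact: wrong_measurable.
rewrite lee_fin ler_expR !(fine_prob_wrong P eta)//.
rewrite -/(excess_hist A u) -/(excess_hist A0 u) -/e -/e0.
set q := fine _ + fine _.
have qle : q <= 2 * a + b * (e + e0).
  apply: (le_trans (prob_wrongD_le P eta P_on_X eta_posterior _ _ mh mh0)).
  have H1 : pX (disagree (hist A u)) <= a + b * e.
    apply: Hab; apply: (disagree_measurable P) => //; exact: measurable_funTS.
  have H2 : pX (disagree (hist A0 u)) <= a + b * e0.
    apply: Hab; apply: (disagree_measurable P) => //; exact: measurable_funTS.
  by rewrite mulrDr; lra.
have -> : - ((n - k)%:R * l / (32 * b)) = (n - k)%:R * - (l / (32 * b)).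
  by rewrite mulrN mulrA.
apply: ler_wpM2l => //.
set L := (8 * b)^-1; have L0 : 0 < L by rewrite /L invr_gt0 mulr_gt0.
have bL : b * L = 8^-1 by rewrite /L invfM mulrCA divff ?mulr1// gt_eqF.
have -> : l / (32 * b) = L * (l / 4) by rewrite /L; field; rewrite gt_eqF.
set ab := a / b.
have aE : a * L = ab / 8 by rewrite /ab /L; field; rewrite gt_eqF.
have e00 : 0 <= e0 by exact: nu_ge0.
have ab0 : 0 <= ab by rewrite divr_ge0 ?(ltW b0).
have ee0' : 4 * e0 + (4 * ab + l) < e by rewrite /ab mulrA.
have h1 : 2 * L ^+ 2 * q <= L * (2 * (2 * (a * L) + (b * L) * (e + e0))).
  have -> : L * (2 * (2 * (a * L) + (b * L) * (e + e0))) = 2 * L ^+ 2 * (2 * a + b * (e +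
    e0)) by ring.
  by apply: ler_wpM2l => //; rewrite mulr_ge0// exprn_ge0// ltW.
rewrite aE bL in h1.
apply: (@le_trans _ _ (L * (2 * (2 * (ab / 8) + 8^-1 * (e + e0)) - (e - e0)))).
  by rewrite mulrBr; lra.
by rewrite -mulrN; apply: ler_wpM2l; [exact: ltW|lra].
Qed.
End validation.

(** * Estimation error *)

Section sign_error.
Context {d : measure_display} {T : measurableType d} {R : realType}.

Lemma prob_pow_sign_error (P : probability T R) n k (L1 L2 : set T) :
  (0 < k <= n)%N -> measurable L1 -> measurable L2 -> L1 `&` L2 = set0 ->
  let M := fine (P L1) - fine (P L2) in
  let p := fine (P L1) + fine (P L2) in
  0 < M ->
  M * fine (prob_pow P n [set D : n.-tuple T |
      \sum_(z <- take k D) (\1_L1 z - \1_L2 z : R) <= 0]) <= 8 * p / (k%:R * M).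
Proof.
move=> /andP[k0 kn] mL1 mL2 L12 M p M0.
have p20 : 0 <= fine (P L2) by exact: fine_ge0.
have Mp : M <= p by rewrite /M /p; lra.
have p0 : 0 < p by lra.
(* The tilt [M / (4 * p)] minimizes [2 * l ^+ 2 * p - l * M], with minimum [- M ^+ 2 / (8 * p)]. *)
have l0 : 0 <= M / (4 * p) <= 2^-1.
  rewrite divr_ge0 ?mulr_ge0 ?(ltW p0) ?(ltW M0)//= ler_pdivrMr ?mulr_gt0//; lra.
have D12 : L1 `\` L2 = L1.
  by apply/seteqP; split => [z []//|z h]; split => // h2; have : set0 z by rewrite -L12.
have D21 : L2 `\` L1 = L2.
  by apply/seteqP; split => [z []//|z h]; split => // h2; have : set0 z by rewrite -L12.
have := prob_pow_indic_sum_le0 P n k L1 L2 _ kn mL1 mL2 l0.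
rewrite D12 D21 -/M -/p; set G := mkset _.
have kR : 0 < k%:R :> R by rewrite ltr0n.
set x := k%:R * M ^+ 2 / (8 * p).
have -> : k%:R * (2 * (M / (4 * p)) ^+ 2 * p - M / (4 * p) * M) = - x.
  by rewrite /x; field; rewrite gt_eqF.
have x0 : 0 < x by rewrite /x divr_gt0 ?mulr_gt0 ?exprn_gt0.
have mG : measurable G.
  rewrite -[X in measurable X]setTI; apply: measurable_fun_le => //.
  by apply: measurable_sum_take; apply: measurable_funB; exact: measurable_indic.
have fG : prob_pow P n G \is a fin_num by rewrite fin_num_measure.
rewrite -[prob_pow P n G]fineK// lee_fin => H.
(* The exponential is weakened to [1 / x] to obtain a bound linear in [p], which can be summed over
   cells. *)
have ex : expR (- x) <= x^-1.
  rewrite expRN lef_pV2 ?posrE ?expR_gt0//.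
  by have := expR_ge1Dx x; lra.
apply: (@le_trans _ _ (M * x^-1)).
  by apply: ler_wpM2l; [exact: ltW|exact: le_trans ex].
have -> : M * x^-1 = 8 * p / (k%:R * M) by rewrite /x; field; rewrite !gt_eqF.
by [].
Qed.
End sign_error.

Section estimation.
Context {R : realType} {d : nat}.
Local Notation E := 'rV[R]_d.
Local Notation Z := (E * bool)%type.
Context (P : probability Z R) (eta : E -> R).
Hypothesis P_on_X : P (cubeX `*` setT) = 1%E.
Hypothesis eta_posterior : is_posterior P eta.
Local Notation PX := (marginalX P).
Local Notation pX := (pX P).
Local Notation nu := (nu P eta).
Local Notation disagree := (disagree eta).
Local Notation excess_hist := (excess_hist P eta).

Let meta : measurable_fun cubeX eta. Proof. by case: eta_posterior. Qed.
Let eta01 x : cubeX x -> 0 <= eta x <= 1. Proof. by case: eta_posterior => _ + _; exact. Qed.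
Let mX := @measurable_cubeX R d.

Lemma pX_label (B : set E) : measurable B ->
  pX B = fine (P (B `*` [set true])) + fine (P (B `*` [set false])).
Proof.
move=> mB; have mS (b : bool) : measurable (B `*` [set b]) by exact: measurableX.
rewrite -fineD ?fin_num_measure// /pX /marginalX /distribution /pushforward; congr fine.
transitivity (P (B `*` [set true] `|` B `*` [set false])).
  by congr (P _); apply/seteqP; split => -[x []]//=; [left|right|case=> -[]|case => -[]].
apply: measureU => //.
by apply/seteqP; split => // -[x b] [[_ /= ->] []].
Qed.

Lemma prob_label_cubeX (B : set E) (b : bool) : measurable B ->
  P (B `*` [set b]) = P ((B `&` cubeX) `*` [set b]).
Proof.
move=> mB; rewrite (prob_on_cubeX P P_on_X); last exact: measurableX.
congr (P _); apply/seteqP; split => -[x c] /=; first by move=> [[? ?] [? _]].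
by move=> [[? ?] ?].
Qed.

(** When one label is favoured throughout [B], the gap is the difference of the two conditional
    label probabilities, and integrating it gives the difference of the label masses. *)
Lemma noise_label (B : set E) (b : bool) : measurable B ->
  (forall x, B x -> cubeX x -> gap eta x = if b then 2 * eta x - 1 else 1 - 2 * eta x) ->
  nu B = fine (P (B `*` [set b])) - fine (P (B `*` [set ~~ b])).
Proof.
move=> mB Hg.
have mBX : measurable (B `&` cubeX) by exact: measurableI.
have mS (c : bool) : measurable (B `*` [set c]) by exact: measurableX.
have meB : measurable_fun (B `&` cubeX) eta by apply: measurable_funS meta => //;
  exact: subIsetr.
have BX : B `&` cubeX `<=` cubeX by exact: subIsetr.
(* The additive form avoids subtraction of extended reals. *)
suff H : (P (B `*` [set b]) = P (B `*` [set ~~ b]) + noise P eta B)%E.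
  rewrite H fineD ?fin_num_measure ?noise_fin//.
  by rewrite addrAC subrr add0r.
have mg : measurable_fun (B `&` cubeX) (EFin \o gap eta).
  by apply: measurable_funS (measurable_gap P eta eta_posterior).
have me1 : measurable_fun (B `&` cubeX) (fun x => (eta x)%:E) by exact/measurable_EFinP.
have me2 : measurable_fun (B `&` cubeX) (fun x => (1 - eta x)%:E).
  by apply/measurable_EFinP; exact: measurable_funB.
have e1 x : (B `&` cubeX) x -> (0 <= (eta x)%:E)%E by move=> [_ /eta01/andP[? _]];
  rewrite lee_fin.
have e2 x : (B `&` cubeX) x -> (0 <= (1 - eta x)%:E)%E by move=> [_ /eta01/andP[_ ?]];
  rewrite lee_fin subr_ge0.
have e3 x : (B `&` cubeX) x -> (0 <= (gap eta x)%:E)%E by move=> _; rewrite lee_fin gap_ge0.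
rewrite !(prob_label_cubeX B)// /noise.
case: b Hg => /= Hg.
  rewrite (prob_true P eta)// (prob_false P eta)// -ge0_integralD//.
  by apply: eq_integral => x /set_mem [Bx Xx]; rewrite -EFinD; congr EFin; rewrite Hg//; lra.
rewrite (prob_true P eta)// (prob_false P eta)// -ge0_integralD//.
by apply: eq_integral => x /set_mem [Bx Xx]; rewrite -EFinD; congr EFin; rewrite Hg//; lra.
Qed.

Lemma nu_bigsetU_le (I : Type) (J : seq I) (F : I -> set E) :
  (forall j, measurable (F j)) ->
  nu (\big[setU/set0]_(j <- J) F j) <= \sum_(j <- J) nu (F j).
Proof.
move=> mF; elim: J => [|j J IH].
  by rewrite !big_nil /nu /noise set0I integral_set0.
rewrite !big_cons; apply: (le_trans (nuU_le P eta eta_posterior _ _ _ _)) => //.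
  exact: bigsetU_measurable.
exact: lerD.
Qed.

Lemma pX_trivI_sum_le (A : nat -> set E) (N : set E) (J : {fset nat}) :
  (forall j, measurable (A j)) -> trivIset setT A -> measurable N ->
  \sum_(j <- J) pX (A j `&` N) <= pX N.
Proof.
move=> mA tA mN.
have mAN j : measurable (A j `&` N) by exact: measurableI.
rewrite -lee_fin /pX -sumEFin fineK ?fin_num_measure//.
under eq_bigr do rewrite fineK ?fin_num_measure//.
rewrite -measure_fbigsetU//.
  apply: le_measure; rewrite ?inE//; first exact: bigsetU_measurable.
  rewrite -bigcup_fset; by apply: bigcup_sub => j _; exact: subIsetr.
by move=> i j _ _ [x [[Ai _] [Aj _]]]; apply: tA => //; exists x.
Qed.

(** * Error of a single histogram *)

Section histogram_error.
Context (A : nat -> set E) (s : R) (n k : nat).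
Hypothesis s_gt0 : 0 < s.
Hypothesis A_part : cube_partition s A.
Hypothesis k_gt0 : (0 < k <= n)%N.

Let cA : forall j, is_cube s (A j). Proof. by case: A_part. Qed.
Let tA : trivIset setT A. Proof. by case: A_part. Qed.
Let mA j : measurable (A j). Proof. exact: measurable_cube (cA j). Qed.

Definition has_pos j := exists2 x, A j x & Xpos eta x.
Definition has_neg j := exists2 x, A j x & Xneg eta x.

(* Meaningful only for cells that do not straddle the decision boundary. *)
Definition cell_label j : bool := ~~ `[< has_neg j >].

Definition sign_error j : set (n.-tuple Z) := [set D |
  \sum_(z <- take k D) (\1_(A j `*` [set cell_label j]) z
                       - \1_(A j `*` [set ~~ cell_label j]) z : R) <= 0].

Lemma measurable_sign_error j : measurable (sign_error j).
Proof.
rewrite -[X in measurable X]setTI; apply: measurable_fun_le => //.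
apply: measurable_sum_take; apply: measurable_funB; apply: measurable_indic;
  exact: measurableX.
Qed.

(** A cell meeting at most one class has one favoured label, so its noise is the difference of its
    two label masses and its mass is their sum, as in [prob_pow_sign_error]. *)
Lemma nonstraddling_sign_error j : ~ (has_pos j /\ has_neg j) -> 0 < nu (A j) ->
  nu (A j) * fine (prob_pow P n (sign_error j)) <= 8 * pX (A j) / (k%:R * nu (A j)).
Proof.
move=> nstr M0.
have mS (b : bool) : measurable (A j `*` [set b]) by exact: measurableX.
have nuE : nu (A j) = fine (P (A j `*` [set cell_label j])) - fine (P (A j `*` [set ~~
  cell_label j])).
  apply: noise_label => // x Ax Xx; rewrite /cell_label /gap.
  case: asboolP => /= hn.
    rewrite ler0_norm; first lra.
    have [e|e] := leP (eta x) (1/2); first lra.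
    by exfalso; apply: nstr; split => //; exists x.
  rewrite ger0_norm//; have [e|e] := leP (1/2) (eta x); first lra.
  by exfalso; apply: hn; exists x.
have pE : pX (A j) = fine (P (A j `*` [set cell_label j])) + fine (P (A j `*` [set ~~
  cell_label j])).
  by rewrite pX_label//; case: (cell_label j) => //=; rewrite addrC.
have := prob_pow_sign_error P n k (A j `*` [set cell_label j]) (A j `*` [set ~~ cell_label
  j]) k_gt0 (mS _) (mS _).
rewrite /= -nuE -pE; apply => //.
by apply/seteqP; split => // -[x b] [[_ /= ->] [_ /=]]; case: (cell_label j).
Qed.

(* Straddling cells and the points with [eta = 1/2] all lie in the near set. *)
Lemma excess_hist_le (J : {fset nat}) (D : n.-tuple Z) :
  (forall j x, A j x -> cubeX x -> j \in J) ->
  excess_hist A (take k D) <= nu (near_set eta (2 * s)) +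
    \sum_(j <- J | ~~ `[< has_pos j /\ has_neg j >]) nu (A j) * \1_(sign_error j) D.
Proof.
move=> HJ; rewrite big_mkcond.
pose F j := if ~~ `[< has_pos j /\ has_neg j >] && (D \in sign_error j) then A j else set0.
have mF j : measurable (F j) by rewrite /F; case: ifP.
have mnear := measurable_near_set eta (2 * s) meta.
have mdis : measurable (disagree (hist A (take k D))).
  by apply: (disagree_measurable P) => //; apply: measurable_funTS; exact: measurable_hist.
have mU : measurable (\big[setU/set0]_(j <- J) F j) by exact: bigsetU_measurable.
have nu0 : nu set0 = 0 by rewrite /nu /noise set0I integral_set0.
apply: (@le_trans _ _ (nu (near_set eta (2 * s) `|` \big[setU/set0]_(j <- J) F j))).
  apply: le_nu => //; first exact: measurableU.
  move=> x [Xx dx].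
  have [j _ Ajx] : (\bigcup_j A j) x by case: A_part => _ _ ->.
  have jJ := HJ j x Ajx Xx.
  have [[[y Ay py] [y' Ay' ny']]|nstr] := pselect (has_pos j /\ has_neg j).
    by left; apply: (straddling_cube_near eta s (A j) y y').
  have [ex|nex] := eqVneq (eta x) (1 / 2).
    left; split => //; rewrite /Delta !memNset; first by rewrite lte_fin mulr_gt0.
      by move=> [_]; rewrite ex ltxx.
    by move=> [_]; rewrite ex ltxx.
  right; rewrite -bigcup_fset; exists j => //; rewrite /F.
  have /asboolPn/negbTE -> /= := nstr; rewrite mem_set//.
  move: dx; rewrite hist_ge0 (cell_sumE A _ j x tA Ajx) /sign_error /cell_label /=.
  (* With cell label -1 a nonnegative vote is an error, with cell label 1 a negative one; the weak
     inequality in [sign_error] covers both, ties included. *)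
  case: asboolP => [hn|hn] /=.
    have -> : (1 / 2 <= eta x) = false.
      apply/negbTE; rewrite -ltNge lt_neqAle nex leNgt; apply/negP => e.
      by apply: nstr; split => //; exists x.
    rewrite eqbF_neg negbK => H; rewrite -oppr_ge0 -sumrN.
    by under eq_bigr do rewrite opprB.
  have -> : (1 / 2 <= eta x) = true.
    by rewrite leNgt; apply/negP => e; apply: hn; exists x.
  by rewrite eqb_id -ltNge => /ltW.
apply: (le_trans (nuU_le P eta eta_posterior _ _ _ _)) => //.
apply: lerD => //; apply: (le_trans (nu_bigsetU_le _ _ _ _)) => //.
apply: ler_sum => j _; rewrite /F indicE.
by case: (~~ _) => /=; case: (D \in sign_error j) => /=; rewrite ?nu0 ?mulr1 ?mulr0.
Qed.

(* A near cell of noise at most [w] is charged [w]; on the others the Chernoff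
   bound is divided by [w], which avoids square roots. *)
Lemma prob_excess_hist (J : {fset nat}) (t tau b b' w th Ka Kn : R) :
  (forall j x, A j x -> cubeX x -> j \in J) ->
  (#|` J|)%:R <= Ka ->
  (forall J' : {fset nat},
     (forall j, j \in J' -> exists2 x, A j x & near_set eta t x) -> (#|` J'|)%:R <= Kn) ->
  0 <= b -> 0 <= b' -> 0 < w -> 0 < th ->
  (forall B, measurable B -> pX B <= pX (B `&` near_set eta tau) + b * nu B) ->
  (forall B, measurable B -> B `&` near_set eta t = set0 -> pX B <= b' * nu B) ->
  (prob_pow P n [set D : n.-tuple Z |
      (nu (near_set eta (2 * s)) + th < excess_hist A (take k D))%R] <=
    (th^-1 * (Kn * (w + 8 * b / k%:R)
       + 8 * pX (near_set eta tau) / (k%:R * w) + Ka * (8 * b' / k%:R)))%:E)%E.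
Proof.
move=> HJ JKa JKn b0 b'0 w0 th0 Hb Hb'.
have kR : 0 < k%:R :> R by rewrite ltr0n; case/andP: k_gt0.
pose str j := `[< has_pos j /\ has_neg j >].
pose J1 := [fset j in J | ~~ str j]%fset.
have mJ1 (F : nat -> R) : \sum_(j <- J | ~~ str j) F j = \sum_(j <- J1) F j.
  by rewrite big_fset_condE.
pose G := [set D : n.-tuple Z | th <= \sum_(j <- J1) nu (A j) * \1_(sign_error j) D].
have mG : measurable G.
  rewrite -[X in measurable X]setTI; apply: measurable_fun_le => //.
  apply: measurable_sum => j; apply: measurable_funM => //.
  by apply: measurable_indic; exact: measurable_sign_error.
have mbad : measurable [set D : n.-tuple Z | nu (near_set eta (2 * s)) + th < excess_hist A
  (take k D)].
  exact: measurable_excess_hist_gt.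
apply: (@le_trans _ _ (prob_pow P n G)).
  apply: le_measure; rewrite ?inE// => D /= h.
  have := excess_hist_le J D HJ; rewrite mJ1 /= => h2.
  by rewrite /G /=; lra.
apply: (le_trans (@markov_indic_sum _ _ _ (prob_pow P n) _ J1 (fun j =>
  nu (A j)) sign_error th th0 _ measurable_sign_error)).
  by move=> j; exact: nu_ge0.
rewrite lee_fin ler_wpM2l ?invr_ge0 ?(ltW th0)//.
pose near j := `[< exists2 x, A j x & near_set eta t x >].
have term j : j \in J1 -> nu (A j) * fine (prob_pow P n (sign_error j)) <=
   (if near j then w + 8 * b / k%:R else 0) + 8 * pX (A j `&` near_set eta tau) / (k%:R * w)
     + 8 * b' / k%:R.
  rewrite !inE /= => /andP[_ /asboolPn nstr].
  have pr1 : fine (prob_pow P n (sign_error j)) <= 1.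
    rewrite -[leRHS]/(fine 1%E); apply: fine_le => //.
      by rewrite fin_num_measure//; exact: measurable_sign_error.
    by apply: probability_le1; exact: measurable_sign_error.
  have M0 : 0 <= nu (A j) by exact: nu_ge0.
  have aj0 : 0 <= pX (A j `&` near_set eta tau) by exact: pX_ge0.
  have t1 : 0 <= 8 * pX (A j `&` near_set eta tau) / (k%:R * w).
    by rewrite divr_ge0 ?mulr_ge0 ?(ltW kR) ?(ltW w0).
  have t2 : 0 <= 8 * b' / k%:R by rewrite divr_ge0 ?mulr_ge0 ?(ltW kR).
  have t3 : 0 <= 8 * b / k%:R by rewrite divr_ge0 ?mulr_ge0 ?(ltW kR).
  have [M00|Mn0] := eqVneq (nu (A j)) 0.
    by rewrite M00 mul0r; case: ifP => _; lra.
  have Mgt0 : 0 < nu (A j) by rewrite lt_neqAle eq_sym Mn0.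
  have H := nonstraddling_sign_error j nstr Mgt0.
  rewrite /near; case: asboolP => nj.
    have [Mw|Mw] := leP (nu (A j)) w.
      have : nu (A j) * fine (prob_pow P n (sign_error j)) <= nu (A j) by rewrite ler_piMr.
      by lra.
    apply: (le_trans H).
    apply: (@le_trans _ _ (8 * pX (A j `&` near_set eta tau) / (k%:R * nu (A j)) + 8 * b /
      k%:R)).
      have -> : 8 * pX (A j `&` near_set eta tau) / (k%:R * nu (A j)) + 8 * b / k%:R =
         8 * (pX (A j `&` near_set eta tau) + b * nu (A j)) / (k%:R * nu (A j)).
        by field; rewrite !gt_eqF.
      by rewrite ler_wpM2r ?invr_ge0 ?mulr_ge0 ?(ltW kR)// ler_wpM2l// Hb.
    have : 8 * pX (A j `&` near_set eta tau) / (k%:R * nu (A j)) <=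
           8 * pX (A j `&` near_set eta tau) / (k%:R * w).
      rewrite ler_wpM2l ?mulr_ge0// lef_pV2 ?posrE ?mulr_gt0//.
      by rewrite ler_wpM2l// ltW.
    by lra.
  apply: (le_trans H).
  suff : 8 * pX (A j) / (k%:R * nu (A j)) <= 8 * b' / k%:R by lra.
  have -> : 8 * b' / k%:R = 8 * (b' * nu (A j)) / (k%:R * nu (A j)).
    by field; rewrite !gt_eqF.
  rewrite ler_wpM2r ?invr_ge0 ?mulr_ge0 ?(ltW kR)// ler_wpM2l// Hb'//.
  by apply/seteqP; split => // x [Ax nx]; apply: nj; exists x.
apply: (@le_trans _ _ (\sum_(j <- J1) ((if near j then w + 8 * b / k%:R else 0) + 8 * pX (A j
  `&` near_set eta tau) / (k%:R * w) + 8 * b' / k%:R))).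
  by rewrite big_seq [leRHS]big_seq; apply: ler_sum => j; exact: term.
(* The three sums use, in turn, the number of near cells, the disjointness of the cells, and the
   total number of cells. *)
rewrite !big_split /=; apply: lerD; first apply: lerD.
- rewrite -big_mkcond /= big_fset_condE /= big_const_seq count_predT iter_addr_0
    -[leLHS]mulr_natl.
  apply: ler_wpM2r; first by rewrite addr_ge0 ?(ltW w0)// divr_ge0 ?mulr_ge0 ?(ltW kR).
  by apply: JKn => j; rewrite !inE /= => /andP[_ /asboolP].
- under eq_bigr do rewrite mulrAC.
  rewrite -mulr_sumr [leRHS]mulrAC; apply: ler_wpM2l;
    first by rewrite divr_ge0 ?mulr_ge0 ?(ltW kR) ?(ltW w0).
  by apply: pX_trivI_sum_le => //; exact: measurable_near_set.
- rewrite big_const_seq count_predT iter_addr_0 -[leLHS]mulr_natl.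
  apply: ler_wpM2r; first by rewrite divr_ge0 ?mulr_ge0 ?(ltW kR).
  apply: le_trans JKa; rewrite ler_nat; apply: fsubset_leq_card.
  by apply/fsubsetP => j; rewrite !inE => /andP[].
Qed.

End histogram_error.
End estimation.

(** * Rates *)

(** One Taylor term of the exponential, of degree [m.+1] with [omega * m.+1 >= k.+1], already beats
    the polynomial and leaves at most [K / n]. It serves to absorb the union bound over [S n]. *)
Lemma poly_expR_small (R : realType) (C k : nat) (c omega e : R) :
  0 < c -> 0 < omega -> 0 < e ->
  exists N0 : nat, forall n, (N0 <= n)%N ->
    (C * n ^ k)%:R * expR (- (c * n%:R `^ omega)) <= e.
Proof.
move=> c0 o0 e0.
pose m := Num.trunc (k.+1%:R / omega).
have mk : k.+1%:R <= omega * m.+1%:R.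
  by rewrite mulrC -ler_pdivrMr// ltW// truncnS_gt.
pose K : R := C%:R * m.+1`!%:R / c ^+ m.+1.
have K0 : 0 <= K by rewrite divr_ge0 ?mulr_ge0 ?exprn_ge0 ?(ltW c0).
exists (Num.trunc (K / e)).+1 => n Nn.
have n0 : (0 < n)%N by exact: leq_trans Nn.
have nR : 0 < n%:R :> R by rewrite ltr0n.
set x := c * n%:R `^ omega.
have x0 : 0 < x by rewrite mulr_gt0 ?powR_gt0.
have xe : expR (- x) <= m.+1`!%:R / x ^+ m.+1.
  rewrite expRN -[leRHS]invrK lef_pV2 ?posrE ?expR_gt0 ?invr_gt0 ?divr_gt0 ?exprn_gt0 ?ltr0n
    ?fact_gt0//.
  rewrite invf_div; have := expR_ge1Dxn m (ltW x0); lra.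
have xm : c ^+ m.+1 * n%:R ^+ k.+1 <= x ^+ m.+1.
  rewrite /x exprMn ler_wpM2l ?exprn_ge0 ?(ltW c0)//.
  rewrite -[(_ `^ _) ^+ _]powR_mulrn ?powR_ge0// -powRrM -[_ ^+ k.+1]powR_mulrn ?(ltW nR)//.
  by rewrite ler_powR// ler1n.
apply: (@le_trans _ _ ((C * n ^ k)%:R * (m.+1`!%:R / (c ^+ m.+1 * n%:R ^+ k.+1)))).
  rewrite ler_wpM2l//; apply: (le_trans xe).
  rewrite ler_wpM2l// lef_pV2 ?posrE ?mulr_gt0 ?exprn_gt0//.
have -> : (C * n ^ k)%:R * (m.+1`!%:R / (c ^+ m.+1 * n%:R ^+ k.+1)) = K / n%:R.
  rewrite /K natrM natrX [n%:R ^+ k.+1]exprSr.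
  have h1 : c ^+ m.+1 != 0 by rewrite expf_neq0// gt_eqF.
  have h2 : (n%:R : R) ^+ k != 0 by rewrite expf_neq0// gt_eqF.
  have h3 : (n%:R : R) != 0 by rewrite gt_eqF.
  set u := c ^+ m.+1 in h1 *; set v := n%:R ^+ k in h2 *; set f := m.+1`!%:R.
  by field; rewrite h1 h2 h3.
rewrite ler_pdivrMr// mulrC -ler_pdivrMr//; apply: ltW.
apply: lt_le_trans (truncnS_gt _) _.
by rewrite ler_nat.
Qed.

(** Both parts keep a fixed fraction of the sample. The factor 4 is attained at [n = 4], where a
    single point is left for validation. *)
Lemma train_size_bounds (n : nat) : (4 <= n)%N ->
  [/\ (0 < n)%N, (0 < n./2.+1 <= n)%N, (n <= n./2.+1 * 2)%N,
      (n <= (n - n./2.+1) * 4)%N & (0 < n - n./2.+1)%N].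
Proof. by move=> n4; split; lia. Qed.

(** * The rate under balanced exponents *)

Section rate_core.
Context {R : realType} {d : nat}.
Local Notation E := 'rV[R]_d.
Local Notation Z := (E * bool)%type.
Context (P : probability Z R) (eta : E -> R).
Hypothesis P_on_X : P (cubeX `*` setT) = 1%E.
Hypothesis eta_posterior : is_posterior P eta.
Local Notation pX := (pX P).
Local Notation nu := (nu P eta).
Local Notation excess_hist := (excess_hist P eta).
Local Notation bad_selection := (bad_selection P eta).

Context (A : R -> nat -> set E) (S : nat -> {fset R})
  (sstar : forall n : nat, n.-tuple Z -> R).
Hypothesis A_partition : forall s : R, 0 < s <= 1 -> cube_partition s (A s).
Hypothesis S_sub : forall (n : nat) (s : R), s \in S n -> 0 < s <= 1.
Hypothesis S_net : forall n : nat, (0 < n)%N -> is_net (n%:R `^ (- d%:R^-1)) (S n).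
Hypothesis S_poly : poly_card S.
Hypothesis sstar_TV : TV_selector A S sstar.

(** [cubeX] is contained in the closed unit ball of the sup-norm, so the cube count bounds every
    finite set of indices of cells meeting it, and this forces the set of all such indices to be
    finite. *)
Lemma finite_cells (B : nat -> set E) (s : R) : 0 < s -> cube_partition s B ->
  exists J : {fset nat}, (forall j x, B j x -> cubeX x -> j \in J) /\
    (#|` J|)%:R <= (2 / s + 2) ^+ d :> R.
Proof.
move=> s0 [cB tB _].
pose J0 := [set j | exists2 x, B j x & cubeX x].
have H (J : {fset nat}) : [set` J] `<=` J0 -> (#|` J|)%:R <= (2 / s + 2) ^+ d :> R.
  move=> JJ0; have := @card_cubes_meeting_ball _ _ B J s 1 0 s0 ler01 cB tB.
  rewrite mulr1; apply => j jJ; have [x Bx Xx] := JJ0 j jJ.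
  by exists x => //; rewrite subr0; apply/normr_rV_le => // i; rewrite ler_norml.
have fJ0 : finite_set J0.
  apply: contrapT => /(infinite_set_fset (Num.trunc ((2 / s + 2) ^+ d)).+1)[J /H JH].
  rewrite -(ler_nat R) => h; have := le_trans h JH.
  by rewrite leNgt truncnS_gt.
exists (fset_set J0); split.
  by move=> j x Bx Xx; rewrite in_fset_set// inE; exists x.
by apply: H => j /=; rewrite in_fset_set// inE.
Qed.

(* The histogram has side length about n^-sigma, n^-theta separates the near
   cells from the far ones, and Ctau n^-phi is the margin at which the mass of a
   set is compared with its noise. *)
Context (r sigma theta phi gamma b Ctau Ca Cn c1 cb : R).
Hypothesis r_gt0 : 0 < r.
Hypothesis sigma_gt0 : 0 < sigma.
Hypothesis sigma_le : sigma <= d%:R^-1.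
Hypothesis theta_ge0 : 0 <= theta.
Hypothesis theta_le : theta <= sigma.
Hypothesis phi_ge0 : 0 <= phi.
Hypothesis gamma_ge0 : 0 <= gamma.
Hypothesis b_sigma : b * sigma = r.
Hypothesis far_balance : gamma * theta + d%:R * sigma - 1 = - r.
Hypothesis near_balance : gamma * phi = theta + gamma * theta.
Hypothesis omega_gt0 : 0 < 1 - r - gamma * phi.
Hypothesis Ctau_gt0 : 0 < Ctau.
Hypothesis Ca_ge0 : 0 <= Ca.
Hypothesis Cn_gt0 : 0 < Cn.
Hypothesis c1_gt0 : 0 < c1.
Hypothesis cb_gt0 : 0 < cb.
Hypothesis ME_tau : forall n, (0 < n)%N ->
  pX (near_set eta (Ctau * n%:R `^ (- phi))) <= Ca * n%:R `^ (gamma * phi - r).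
Hypothesis MNE_b : forall t, 0 < t -> nu (near_set eta t) <= (cb * t) `^ b.
Hypothesis noise_lower : forall (t : R) (B : set E), 0 < t -> measurable B ->
  pX B <= pX (B `&` near_set eta t) + c1 * t `^ (- gamma) * nu B.
Hypothesis near_cells : forall (B : nat -> set E) (J : {fset nat}) (s t : R),
    0 < s -> 0 < t <= 1 -> s <= 3 * t ->
    (forall j, is_cube s (B j)) -> trivIset setT B ->
    (forall j, j \in J -> exists2 x, B j x & near_set eta t x) ->
    (#|` J|)%:R <= Cn * (t * s^-1 ^+ d).

Let b_ge0 : 0 <= b. Proof. by rewrite -(pmulr_lge0 _ sigma_gt0) b_sigma ltW. Qed.

(** The maximum with 1 makes the noise factor at least 1, as [prob_bad_selection] demands. *)
Let Cb := Num.max 1 (c1 * Ctau `^ (- gamma)).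
Let Cb1 : 1 <= Cb. Proof. by rewrite le_max lexx. Qed.

Let Cb0 : 0 < Cb. Proof. exact: lt_le_trans ltr01 Cb1. Qed.

Let powD (n : nat) (x y : R) : (0 < n)%N -> n%:R `^ x * n%:R `^ y = n%:R `^ (x + y) :> R.
Proof. by move=> n0; rewrite powRD// pnatr_eq0 -lt0n n0 implybT. Qed.

Lemma noise_lower_tau n (B : set E) : (0 < n)%N -> measurable B ->
  pX B <= pX (B `&` near_set eta (Ctau * n%:R `^ (- phi)))
     + Cb * n%:R `^ (gamma * phi) * nu B.
Proof.
move=> n0 mB; have nR : 0 < n%:R :> R by rewrite ltr0n.
have t0 : 0 < Ctau * n%:R `^ (- phi) by rewrite mulr_gt0 ?powR_gt0.
apply: (le_trans (noise_lower _ _ t0 mB)); apply: lerD => //.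
apply: ler_wpM2r; first exact: nu_ge0.
rewrite powRM ?powR_ge0 ?(ltW Ctau_gt0)// -powRrM mulrNN [phi * _]mulrC mulrA.
by rewrite ler_wpM2r ?powR_ge0// /Cb le_max lexx orbT.
Qed.

(** [prob_excess_hist] is applied to one candidate of side about [n ^ (- sigma)]; the balance
    hypotheses bring each of its terms to order [n ^ (- r)]. *)
Lemma estimation_rate : exists K1 K2 : R, [/\ 0 < K1, 0 < K2 &
  forall n, (4 <= n)%N -> 2 * n%:R `^ (- sigma) <= 1 :> R ->
  exists2 s1, s1 \in S n & forall th : R, 0 < th ->
    (prob_pow P n [set D : n.-tuple Z |
       ((K2 + th) * n%:R `^ (- r) < excess_hist (A s1) (take n./2.+1 D))%R]
     <= (K1 / th)%:E)%E].
Proof.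
pose K1 := Cn * (1 + 16 * Cb) + 16 * Ca + 16 * 4 ^+ d * c1.
exists K1, ((6 * cb) `^ b).
split; [|by rewrite powR_gt0// mulr_gt0|].
  have p1 : 0 < Cn * (1 + 16 * Cb) by rewrite mulr_gt0// addr_gt0// mulr_gt0.
  have p2 : 0 <= 16 * Ca by rewrite mulr_ge0.
  have p3 : 0 <= 16 * 4 ^+ d * c1 by rewrite !mulr_ge0 ?exprn_ge0 ?(ltW c1_gt0).
  by rewrite /K1; lra.
move=> n n4 s01.
have [n0 kn kn2 kn4 nk0] := train_size_bounds n n4.
have nR : 0 < n%:R :> R by rewrite ltr0n.
have n1 : 1 <= n%:R :> R by rewrite ler1n.
set s0 := n%:R `^ (- sigma) in s01 *.
have s0gt0 : 0 < s0 by exact: powR_gt0.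
(* Aiming the net at [2 * s0] puts [s1] between [s0] and [3 * s0], since the mesh is at most [s0] by
   [sigma <= 1 / d]. *)
have [|s1 s1S s1s0] := S_net n n0 (2 * s0); first by rewrite mulr_gt0.
exists s1 => // th th0.
have s0net : n%:R `^ (- d%:R^-1) <= s0 by rewrite /s0 ler_powR// lerN2.
have /andP[s1lo s1hi] : s0 <= s1 <= 3 * s0.
  by move: (le_trans s1s0 s0net); rewrite ler_norml => /andP[? ?]; apply/andP; split; lra.
have s1gt0 : 0 < s1 by lra.
have /andP[_ s1le1] := S_sub n s1 s1S.
have part := A_partition s1 (S_sub n s1 s1S).
have [J [HJ cJ]] := finite_cells (A s1) s1 s1gt0 part.
set k := n./2.+1 in kn kn2 kn4 *.
have kR : 0 < k%:R :> R by rewrite ltr0n.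
have kV : k%:R^-1 <= 2 * n%:R `^ (- 1) :> R.
  rewrite powR_inv1 ?(ltW nR)// -[2]invrK -invfM lef_pV2 ?posrE ?mulr_gt0 ?invr_gt0//.
  by rewrite mulrC ler_pdivrMr// -natrM ler_nat.
pose t : R := n%:R `^ (- theta).
have t0 : 0 < t by exact: powR_gt0.
have t1 : t <= 1 by rewrite -(powRr0 n%:R) ler_powR// oppr_le0.
have st : s1 <= 3 * t.
  by apply: (le_trans s1hi); rewrite ler_wpM2l// ler_powR// lerN2.
have sd : s1^-1 ^+ d <= n%:R `^ (d%:R * sigma).
  apply: (@le_trans _ _ (s0^-1 ^+ d)).
    by rewrite lerXn2r ?nnegrE ?invr_ge0 ?(ltW s0gt0) ?(ltW s1gt0)// lef_pV2.
  by rewrite /s0 -powRN opprK -powR_mulrn ?powR_ge0// -powRrM mulrC.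
pose rho : R := n%:R `^ (- r).
have rho0 : 0 < rho by exact: powR_gt0.
(* The noise level charged to a near cell is chosen so that all near cells together cost
   [Cn * n ^ (- r)]. *)
pose w : R := n%:R `^ (theta - d%:R * sigma - r).
have w0 : 0 < w by exact: powR_gt0.
pose Kn : R := Cn * n%:R `^ (d%:R * sigma - theta).
pose Ka : R := 4 ^+ d * n%:R `^ (d%:R * sigma).
have JKa : (#|` J|)%:R <= Ka.
  apply: (le_trans cJ); apply: (@le_trans _ _ (4 ^+ d * s1^-1 ^+ d)); last first.
    by rewrite ler_wpM2l// exprn_ge0.
  rewrite -exprMn lerXn2r ?nnegrE//.
  - by rewrite addr_ge0// divr_ge0// ltW.
  - by rewrite mulr_ge0// invr_ge0 ltW.
  - have : 1 <= s1^-1 by rewrite -[X in X <= _]invr1 lef_pV2 ?posrE.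
    by lra.
have JKn (J' : {fset nat}) : (forall j, j \in J' -> exists2 x, A s1 j x & near_set eta t x) ->
    (#|` J'|)%:R <= Kn.
  move=> H; case: part => cA tA _.
  apply: (le_trans (near_cells (A s1) J' s1 t s1gt0 _ st cA tA H)); first by rewrite t0.
  rewrite /Kn ler_wpM2l ?(ltW Cn_gt0)// addrC -powD// -/t.
  by rewrite ler_wpM2l// ltW.
have Hb := noise_lower_tau n.
have Hb' B : measurable B -> B `&` near_set eta t = set0 -> pX B <= (c1 * n%:R `^ (gamma *
  theta)) * nu B.
  move=> mB B0; have := noise_lower t B t0 mB.
  rewrite B0 pX_set0 add0r /t -powRrM mulrNN [theta * _]mulrC; exact.
have cbn : 0 <= Cb * n%:R `^ (gamma * phi) by rewrite mulr_ge0 ?powR_ge0// ltW.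
have c1n : 0 <= c1 * n%:R `^ (gamma * theta) by rewrite mulr_ge0 ?powR_ge0// ltW.
have thr : 0 < th * rho by rewrite mulr_gt0.
have main := prob_excess_hist P eta P_on_X eta_posterior (A s1) s1 n k s1gt0 part kn J t
   (Ctau * n%:R `^ (- phi)) _ _ w (th * rho) Ka Kn HJ JKa JKn cbn c1n w0 thr
   (fun B => Hb B n0) Hb'.
apply: (@le_trans _ _ (prob_pow P n [set D : n.-tuple Z |
      (nu (near_set eta (2 * s1)) + th * rho < excess_hist (A s1) (take k D))%R])).
  have mA j : measurable (A s1 j) by case: part => cA _ _; exact: measurable_cube (cA j).
  apply: le_measure; rewrite ?inE//; try exact: measurable_excess_hist_gt.
  (* The straddling cells: [2 * s1 <= 6 * s0], so MNE bounds their noise by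
     [(6 * cb) ^ b * n ^ (- r)], because [b * sigma = r]. *)
  move=> D /=; apply: le_lt_trans; rewrite -/rho [leRHS]mulrDl lerD2r.
  apply: (le_trans (MNE_b _ _)); first by rewrite mulr_gt0.
  apply: (@le_trans _ _ ((6 * cb * s0) `^ b)).
    apply: ge0_ler_powR => //; rewrite ?nnegrE ?mulr_ge0 ?(ltW cb_gt0) ?(ltW s1gt0) ?(ltW
      s0gt0)//.
    by rewrite [6 * cb]mulrC -mulrA ler_wpM2l ?(ltW cb_gt0)//; lra.
  rewrite powRM ?mulr_ge0 ?(ltW cb_gt0) ?(ltW s0gt0)// /s0 -powRrM mulNr [sigma * b]mulrC
    b_sigma//.
apply: (le_trans main); rewrite lee_fin.
have -> : K1 / th = (th * rho)^-1 * (K1 * rho) by field; rewrite !gt_eqF.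
rewrite ler_wpM2l ?invr_ge0 ?(ltW thr)//.
have h1 : Kn * w = Cn * rho.
  by rewrite /Kn /w -mulrA powD//; congr (_ * _ `^ _); ring.
(* By [near_balance], the factor [n ^ (- theta)] saved in the number of near cells pays exactly for
   the larger noise factor [n ^ (gamma * phi)]. *)
have h2 : Kn * (8 * (Cb * n%:R `^ (gamma * phi)) / k%:R) <= 16 * Cn * Cb * rho.
  apply: (@le_trans _ _ (Kn * (8 * (Cb * n%:R `^ (gamma * phi)) * (2 * n%:R `^ (- 1))))).
    rewrite ler_wpM2l ?mulr_ge0 ?powR_ge0 ?(ltW Cn_gt0)// ler_wpM2l// mulr_ge0//.
  rewrite /Kn [leLHS](_ : _ = 16 * Cn * Cb * (n%:R `^ (d%:R * sigma - theta) * n%:R `^ (gamma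
    * phi) * n%:R `^ (- 1))).
    rewrite !powD//; suff -> : d%:R * sigma - theta + gamma * phi + -1 = - r by [].
    by rewrite near_balance -far_balance; ring.
  by ring.
have h3 : 8 * pX (near_set eta (Ctau * n%:R `^ (- phi))) / (k%:R * w) <= 16 * Ca * rho.
  rewrite invfM mulrA.
  have wV : w^-1 = n%:R `^ (r + d%:R * sigma - theta) by rewrite /w -powRN; congr (_ `^ _);
    ring.
  apply: (@le_trans _ _ (8 * (Ca * n%:R `^ (gamma * phi - r)) * (2 * n%:R `^ (- 1)) / w)).
    rewrite ler_wpM2r ?invr_ge0 ?(ltW w0)// ler_pM ?invr_ge0 ?(ltW kR)//.
      by rewrite mulr_ge0// pX_ge0.
    by rewrite ler_wpM2l// ME_tau.
  rewrite wV [leLHS](_ : _ = 16 * Ca * (n%:R `^ (gamma * phi - r) * n%:R `^ (- 1) * n%:R `^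
    (r + d%:R * sigma - theta))).
    rewrite !powD//; suff -> : gamma * phi - r + -1 + (r + d%:R * sigma - theta) = - r by [].
    transitivity (d%:R * sigma - theta + gamma * phi + -1); first by ring.
    by rewrite near_balance -far_balance; ring.
  by ring.
have h4 : Ka * (8 * (c1 * n%:R `^ (gamma * theta)) / k%:R) <= 16 * 4 ^+ d * c1 * rho.
  apply: (@le_trans _ _ (Ka * (8 * (c1 * n%:R `^ (gamma * theta)) * (2 * n%:R `^ (- 1))))).
    rewrite ler_wpM2l ?mulr_ge0 ?powR_ge0 ?exprn_ge0// ler_wpM2l// mulr_ge0//.
  rewrite /Ka [leLHS](_ : _ = 16 * 4 ^+ d * c1 * (n%:R `^ (d%:R * sigma) * n%:R `^ (gamma *
    theta) * n%:R `^ (- 1))).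
    rewrite !powD//; suff -> : d%:R * sigma + gamma * theta + -1 = - r by [].
    by rewrite -far_balance; ring.
  by ring.
rewrite /K1 [Kn * (_ + _)]mulrDr.
rewrite [leRHS](_ : _ = (Cn * rho + 16 * Cn * Cb * rho) + 16 * Ca * rho + 16 * 4 ^+ d * c1 *
  rho); last by ring.
by rewrite lerD// lerD// lerD// h1.
Qed.

(** The constants for [prob_bad_selection] come from the margin [tau = Ctau * n ^ (- phi)]: [a]
    bounds the mass of its near set, and [bn] is the factor of the noise outside. *)
Lemma validation_rate : exists K3 c3 : R, [/\ 0 < K3, 0 < c3 &
  forall n, (4 <= n)%N -> forall s s1, s \in S n -> s1 \in S n ->
    (prob_pow P n [set D : n.-tuple Z |
       bad_selection (A s) (A s1) (K3 * n%:R `^ (- r)) n./2.+1 D]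
     <= (expR (- (c3 * n%:R `^ (1 - r - gamma * phi))))%:E)%E].
Proof.
exists (4 * Ca / Cb + 1), (128 * Cb)^-1.
split; [|by rewrite invr_gt0 mulr_gt0|].
  by rewrite ltr_wpDl// divr_ge0 ?mulr_ge0 ?(ltW Cb0).
move=> n n4 s s1 sS s1S.
have [n0 kn kn2 kn4 nk0] := train_size_bounds n n4.
have nR : 0 < n%:R :> R by rewrite ltr0n.
have n1 : 1 <= n%:R :> R by rewrite ler1n.
have {}kn : (n./2.+1 <= n)%N by case/andP: kn.
set k := n./2.+1 in kn kn2 kn4 *.
have mA s' : s' \in S n -> forall j, measurable (A s' j).
  by move=> /S_sub/A_partition[cA _ _] j; exact: measurable_cube (cA j).
pose a : R := Ca * n%:R `^ (gamma * phi - r).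
pose bn : R := Cb * n%:R `^ (gamma * phi).
have pg : 0 < n%:R `^ (gamma * phi) :> R by exact: powR_gt0.
have bn1 : 1 <= bn.
  rewrite /bn -[X in X <= _]mulr1 ler_pM//.
  by rewrite -[X in X <= _](powRr0 n%:R) ler_powR// mulr_ge0.
have a0 : 0 <= a by rewrite mulr_ge0// powR_ge0.
have Hab B : measurable B -> pX B <= a + bn * nu B.
  move=> mB; apply: (le_trans (noise_lower_tau n B n0 mB)); apply: lerD => //.
  apply: le_trans (ME_tau n n0).
  have mnear : measurable (near_set eta (Ctau * n%:R `^ (- phi))).
    by apply: measurable_near_set; case: eta_posterior.
  apply: fine_le; rewrite ?fin_num_measure//; first exact: measurableI.
  by apply: le_measure; rewrite ?inE//; exact: measurableI.
have rho0 : 0 <= n%:R `^ (- r) :> R by exact: powR_ge0.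
have := prob_bad_selection P eta P_on_X eta_posterior (A s) (A s1) n k a bn _ kn (mA s sS)
  (mA s1 s1S) a0 bn1 rho0 Hab.
(* The powers [n ^ (gamma * phi)] in [a] and [bn] cancel, so the threshold is of the order of the
   target rate. *)
have -> : 4 * a / bn + n%:R `^ (- r) = (4 * Ca / Cb + 1) * n%:R `^ (- r).
  rewrite /a /bn -powD//; field.
  by rewrite !gt_eqF.
move=> /le_trans; apply; rewrite lee_fin ler_expR lerN2.
have -> : (128 * Cb)^-1 * n%:R `^ (1 - r - gamma * phi) =
    (n%:R / 4) * n%:R `^ (- r) / (32 * bn).
  rewrite -powD// -powD// powRr1 ?(ltW nR)// [n%:R `^ (- (gamma * phi))]powRN [in RHS]/bn.
  by field; rewrite !gt_eqF.
apply: ler_wpM2r; first by rewrite invr_ge0 mulr_ge0// (le_trans _ bn1).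
apply: ler_wpM2r => //.
by rewrite ler_pdivrMr// -natrM ler_nat.
Qed.

Lemma learns_core : learns_with_rate P (TV_HR A sstar) (fun n : nat => n%:R `^ (- r)).
Proof.
have [K1 [K2 [K10 K20 est]]] := estimation_rate.
have [K3 [c3 [K30 c30 val]]] := validation_rate.
move=> eps /andP[eps0 eps1].
(* This choice makes [K1 / th] equal to [eps / 2]; the other half of [eps] is kept for the union
   bound over [S n]. *)
pose th := 2 * K1 / eps.
have th0 : 0 < th by rewrite divr_gt0// mulr_gt0.
exists (4 * (K2 + th) + K3); first by rewrite addr_gt0// mulr_gt0// addr_gt0.
have [C [kk HC]] := S_poly.
have e20 : 0 < eps / 2 by rewrite divr_gt0.
have [N1 HN1] := poly_expR_small R C kk c3 _ (eps / 2) c30 omega_gt0 e20.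
pose N2 := (Num.trunc (2 `^ sigma^-1 : R)).+1.
exists (maxn 4 (maxn N1 N2)) => // n /=; rewrite !geq_max => /andP[n4 /andP[nN1 nN2]].
have [n0 kn kn2 kn4 nk0] := train_size_bounds n n4.
have nR : 0 < n%:R :> R by rewrite ltr0n.
have s01 : 2 * n%:R `^ (- sigma) <= 1 :> R.
  rewrite powRN ler_pdivrMr ?powR_gt0// mul1r.
  have : 2 `^ sigma^-1 <= n%:R :> R.
    by apply: ltW; apply: lt_le_trans (truncnS_gt _) _; rewrite ler_nat.
  move=> /(ge0_ler_powR (ltW sigma_gt0)); rewrite !nnegrE => /(_ (powR_ge0 _ _) (ltW nR)).
  by rewrite -powRrM mulVf ?gt_eqF// powRr1.
have [s1 s1S est1] := est n n4 s01.
set k := n./2.+1.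
have mA s' : s' \in S n -> forall j, measurable (A s' j).
  by move=> /S_sub/A_partition[cA _ _] j; exact: measurable_cube (cA j).
pose rho : R := n%:R `^ (- r).
pose G0 := [set D : n.-tuple Z | (K2 + th) * rho < excess_hist (A s1) (take k D)].
pose G s := [set D : n.-tuple Z | bad_selection (A s) (A s1) (K3 * rho) k D].
have mG0 : measurable G0 by apply: measurable_excess_hist_gt => //; exact: mA.
have mG s : s \in S n -> measurable (G s).
  by move=> sS; apply: measurable_bad_selection => //; exact: mA.
(* The union runs over all candidates because the chosen one depends on the sample, and [sstar]
   carries no measurability. The guard makes every member of the family measurable. *)
pose GU := \big[setU/set0]_(s <- S n) (if s \in S n then G s else set0).
have mGU : measurable GU.
  by apply: bigsetU_measurable => s _; case: ifP => // /mG.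
exists (~` (G0 `|` GU)); split.
- by apply: measurableC; exact: measurableU.
- move=> D /= /not_orP[nG0 nGU].
  have [sS smin] := sstar_TV n n4 D.
  set s := sstar n D in sS smin *.
  rewrite /TV_HR -/s.
  have sz : size D = n by exact: size_tuple.
  have trE : train D = take k D by rewrite /train sz.
  have vaE : valid D = drop k D by rewrite /valid sz.
  rewrite (risk_excess P eta)//; last by apply: measurable_funTS; apply: measurable_hist;
    exact: mA.
  rewrite lee_fin trE -/(excess_hist (A s) (take k D)).
  have h0 : excess_hist (A s1) (take k D) <= (K2 + th) * rho.
    by rewrite leNgt; apply/negP => h; apply: nG0.
  have nGs : ~ bad_selection (A s) (A s1) (K3 * rho) k D.
    by move=> h; apply: nGU; rewrite /GU -bigcup_fset; exists s => //; rewrite sS.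
  (* Minimality of the selected [s] is the second clause of [bad_selection]; as the event is
     excluded, the first clause must fail. *)
  have sum0 : \sum_(z <- drop k D)
    (\1_(wrong (hist (A s) (take k D))) z - \1_(wrong (hist (A s1) (take k D))) z : R) <= 0.
    have := smin s1 s1S; rewrite /emp_risk vaE trE.
    rewrite ler_pM2l; last first.
      by rewrite invr_gt0 ltr0n size_drop sz.
    rewrite sumrB subr_le0.
    by under eq_bigr do rewrite loss_wrong; under [leRHS]eq_bigr do rewrite loss_wrong.
  have : excess_hist (A s) (take k D) <= 4 * excess_hist (A s1) (take k D) + K3 * rho.
    by rewrite leNgt; apply/negP => h; apply: nGs.
  move=> /le_trans; apply; rewrite -/rho [leRHS]mulrDl lerD2r -[leRHS]mulrA.
  by rewrite ler_wpM2l.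
- rewrite probability_setC; last exact: measurableU.
  rewrite EFinB; apply: leeB => //.
  apply: (le_trans (measureU2 _ mG0 mGU)) => //.
  have -> : eps = K1 / th + eps / 2.
    by rewrite /th; field; rewrite !gt_eqF.
  rewrite EFinD; apply: leeD; first exact: est1.
  apply: (@le_trans _ _ (\sum_(s <- S n) (expR (- (c3 * n%:R `^ (1 - r - gamma * phi))))%:E)%E).
    have mF s : measurable (if s \in S n then G s else set0) by case: ifP => // /mG.
    rewrite /GU; elim: (S n : seq R) => [|s l IH]; first by rewrite !big_nil measure0.
    rewrite !big_cons; apply: (le_trans (measureU2 _ _ _)) => //.
      exact: bigsetU_measurable.
    apply: leeD => //; case: ifPn => [sS|_]; first exact: val.
    by rewrite measure0 lee_fin expR_ge0.
  rewrite sumEFin lee_fin big_const_seq count_predT iter_addr_0 -[leLHS]mulr_natl.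
  apply: le_trans (HN1 n nN1); rewrite ler_wpM2r ?expR_ge0// ler_nat.
  exact: HC.
Qed.

End rate_core.

(** * Margin exponents as inequalities between reals *)

Section exponents.
Context {R : realType} {d : nat}.
Local Notation E := 'rV[R]_d.
Local Notation Z := (E * bool)%type.
Context (P : probability Z R) (eta : E -> R).
Hypothesis eta_posterior : is_posterior P eta.
Let meta : measurable_fun cubeX eta. Proof. by case: eta_posterior. Qed.

Lemma pX_le1 (B : set E) : measurable B -> pX P B <= 1.
Proof.
move=> mB; rewrite -[leRHS]/(fine 1%E); apply: fine_le => //.
  by rewrite fin_num_measure.
exact: probability_le1.
Qed.

Lemma has_MNE_nu (beta : \bar R) : has_MNE P eta beta -> exists2 c : R, 0 < c &
  forall t, 0 < t -> ((nu P eta (near_set eta t))%:E <= powx (c * t) beta)%E.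
Proof.
move=> [c c0 H]; exists c => // t t0.
have mnear := measurable_near_set eta t meta.
rewrite /nu fineK ?noise_fin// /noise setIidl; first exact: H.
by move=> x [].
Qed.

(** An infinite exponent yields every finite [b]: for [c * t < 1] the noise vanishes, and otherwise
    it is at most 1, which is at most [(c * t) ^ b]. *)
Lemma MNE_powR (beta : \bar R) (b : R) : 0 < b -> (beta = b%:E \/ beta = +oo%E) ->
  has_MNE P eta beta -> exists2 c : R, 0 < c &
  forall t, 0 < t -> nu P eta (near_set eta t) <= (c * t) `^ b.
Proof.
move=> b0 bE /has_MNE_nu[c c0 H]; exists c => // t t0; have := H t t0.
case: bE => -> /=; first by rewrite lee_fin.
case: ltP => ct; first by rewrite lee_fin => /le_trans; apply; exact: powR_ge0.
move=> _; apply: (@le_trans _ _ 1); last by rewrite -(powRr0 (c * t)) ler_powR// ltW.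
have mnear := measurable_near_set eta t meta.
by apply: (le_trans (nu_le_pX P eta eta_posterior _ mnear)); exact: pX_le1.
Qed.

Lemma has_ME_pX (alpha : \bar R) : has_ME P eta alpha -> exists2 c : R, 0 < c &
  forall t, 0 < t -> ((pX P (near_set eta t))%:E <= powx (c * t) alpha)%E.
Proof.
move=> [c c0 H]; exists c => // t t0.
have mnear := measurable_near_set eta t meta.
by rewrite /pX fineK ?fin_num_measure//; exact: H.
Qed.
End exponents.

(** * Choice of the exponents *)

Section main.
Context {R : realType} {d : nat}.
Local Notation E := 'rV[R]_d.
Local Notation Z := (E * bool)%type.

(** Separating the real [b] from [beta] lets one argument serve both a finite [beta], where they
    agree, and [beta = +oo], where [b] is arbitrary. *)
Lemma learns_finite_beta (P : probability Z R) (eta : E -> R)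
    (alpha beta : \bar R) (gamma b : R)
    (A : R -> nat -> set E) (S : nat -> {fset R})
    (sstar : forall n : nat, n.-tuple Z -> R) :
  P (cubeX `*` setT) = 1%E -> is_posterior P eta -> 0 <= gamma ->
  controls_noise_below P eta gamma ->
  0 < b -> beta = b%:E \/ beta = +oo%E -> has_MNE P eta beta ->
  (0 < alpha)%E -> has_ME P eta alpha ->
  Xzero eta = rel_boundary (Xpos eta) -> Xzero eta = rel_boundary (Xneg eta) ->
  rectifiable d.-1 (Xzero eta) ->
  (beta <= gamma%:E^-1 * kappa gamma alpha)%E ->
  (forall s : R, 0 < s <= 1 -> cube_partition s (A s)) ->
  (forall (n : nat) (s : R), s \in S n -> 0 < s <= 1) ->
  (forall n : nat, (0 < n)%N -> is_net (n%:R `^ (- d%:R^-1)) (S n)) ->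
  poly_card S -> TV_selector A S sstar ->
  learns_with_rate P (TV_HR A sstar)
    (fun n : nat => n%:R `^ (- rate_exponent d gamma alpha b)).
Proof.
move=> PX1 post g0 ctrl b0 bE mne a0 me Xp Xn rect ble part Ssub net poly TV.
have [c1 c10 lower] := marginal_le_near P eta PX1 post gamma g0 ctrl.
have [cb cb0 MNE] := MNE_powR P eta post beta b b0 bE mne.
have [ca ca0 ME] := has_ME_pX P eta post alpha me.
(* Rectifiability includes a positive dimension, so [d - 1 > 0]. *)
have d2 : (1 < d)%N by case: rect => + _; rewrite -subn1 subn_gt0.
have dR : 2 <= d%:R :> R by rewrite ler_nat.
have [Cn Cn0 cells] := card_cubes_near_boundary eta Xp Xn (ltnW d2) rect.
case: alpha a0 ME ble {me} => [a| |] // a0 ME ble.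
- rewrite lte_fin in a0.
  pose kap := (1 + gamma) * (a + gamma).
  have kE : kappa gamma a%:E = kap%:E by [].
  have kap0 : 0 < kap by rewrite mulr_gt0//; lra.
  have bg : b * gamma <= kap.
    (* For [gamma = 0] the claim is just [0 <= kap]; for [gamma > 0] the finite bound on [beta]
       rules out [beta = +oo]. *)
    have [->|gn0] := eqVneq gamma 0; first by rewrite mulr0 ltW.
    have gp : 0 < gamma by rewrite lt_neqAle eq_sym gn0.
    move: ble; rewrite kE inver (negbTE gn0) -EFinM; case: bE => -> //.
    by rewrite lee_fin mulrC ler_pdivlMr.
  rewrite /rate_exponent kE.
  set Q := b * (kap + gamma ^+ 2) + d%:R * kap.
  have g20 : 0 <= gamma ^+ 2 by rewrite exprn_ge0.
  have bk0 : 0 < b * kap by rewrite mulr_gt0.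
  have Q1 : d%:R * kap <= Q by rewrite /Q lerDr mulr_ge0 ?addr_ge0 ?(ltW b0) ?(ltW kap0).
  have Q0 : 0 < Q by apply: lt_le_trans Q1; rewrite mulr_gt0//; lra.
  have Qn : Q != 0 by rewrite gt_eqF.
  (* The exponents are [r = b * kap / Q], [sigma = kap / Q], [theta = b * gamma / Q] and
     [phi = b * (1 + gamma) / Q]. They solve the balance equations together with
     [phi * (a + gamma) = r], which is what ME requires. *)
  apply: (learns_core P eta PX1 post A S sstar part Ssub net poly TV (b * kap / Q)
    (kap / Q) (b * gamma / Q) (b * (1 + gamma) / Q) gamma b 1 (ca `^ a) Cn c1 cb) => //.
  + by rewrite divr_gt0.
  + by rewrite divr_gt0.
  + have dp : 0 < d%:R :> R by lra.
    by rewrite ler_pdivrMr// [leRHS]mulrC ler_pdivlMr// [leLHS]mulrC.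
  + by rewrite divr_ge0 ?mulr_ge0 ?(ltW b0) ?(ltW Q0).
  + by rewrite ler_wpM2r// invr_ge0 ltW.
  + by apply: divr_ge0; [apply: mulr_ge0; lra|exact: ltW].
  + by rewrite mulrA.
  + by rewrite /Q; field; exact: Qn.
  + by field; rewrite gt_eqF.
  (* The exponent of the validation bound is positive because [b * gamma <= kap < d * kap]. *)
  + have -> : 1 - b * kap / Q - gamma * (b * (1 + gamma) / Q) = (d%:R * kap - b * gamma) / Q.
      by rewrite /Q; field; exact: Qn.
    rewrite divr_gt0// subr_gt0; apply: (le_lt_trans bg).
    by rewrite ltr_pMl//; lra.
  + exact: powR_ge0.
  + move=> n n0; have nR : 0 < n%:R :> R by rewrite ltr0n.
    rewrite mul1r; have := ME (n%:R `^ (- (b * (1 + gamma) / Q))) (powR_gt0 _ nR).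
    rewrite /= lee_fin powRM ?powR_ge0 ?(ltW ca0)// -powRrM.
    suff -> : - (b * (1 + gamma) / Q) * a = gamma * (b * (1 + gamma) / Q) - b * kap / Q by [].
    by rewrite /kap; field; rewrite gt_eqF.
- have kE : kappa gamma +oo = +oo%E.
    by rewrite /kappa addye// gt0_muley// lte_fin; lra.
  rewrite /rate_exponent kE.
  have bd : 0 < b + d%:R by lra.
  (* For [alpha = +oo] a fixed margin suffices, so [theta = phi = 0]. With [Ctau = 1 / (2 * ca)] the
     ME bound is taken at 1/2, where its infinite power is 0; hence [Ca = 0]. *)
  apply: (learns_core P eta PX1 post A S sstar part Ssub net poly TV (b / (b + d%:R))
    (b + d%:R)^-1 0 0 gamma b (2 * ca)^-1 0 Cn c1 cb) => //.
  + by rewrite divr_gt0.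
  + by rewrite invr_gt0.
  + by rewrite lef_pV2 ?posrE//; lra.
  + by rewrite invr_ge0 ltW.
  + by field; rewrite gt_eqF.
  + by rewrite !mulr0 addr0.
  + rewrite mulr0 subr0 subr_gt0 ltr_pdivrMr//; lra.
  + by rewrite invr_gt0 mulr_gt0.
  + move=> n n0; rewrite oppr0 powRr0 mulr1 mul0r.
    have := ME (2 * ca)^-1; rewrite invr_gt0 mulr_gt0// => /(_ isT).
    have -> : ca * (2 * ca)^-1 = 2^-1 by field; rewrite gt_eqF.
    by rewrite /= ifT ?lee_fin//; lra.
Qed.
End main.
Theorem theorem3p7 (R : realType) (d : nat)
    (P : probability ('rV[R]_d * bool)%type R) (eta : 'rV[R]_d -> R)
    (alpha beta : \bar R) (gamma : R)
    (A : R -> nat -> set 'rV[R]_d) (S : nat -> {fset R})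
    (sstar : forall n : nat, n.-tuple ('rV[R]_d * bool)%type -> R)
    (P_on_X : P (cubeX `*` setT) = 1%E)
    (eta_posterior : is_posterior P eta)
    (gamma_ge0 : 0 <= gamma)
    (noise_control : controls_noise_below P eta gamma)
    (beta_gt0 : (0 < beta)%E)
    (P_MNE : has_MNE P eta beta)
    (alpha_gt0 : (0 < alpha)%E)
    (P_ME : has_ME P eta alpha)
    (X0_bdry_pos : Xzero eta = rel_boundary (Xpos eta))
    (X0_bdry_neg : Xzero eta = rel_boundary (Xneg eta))
    (X0_hausdorff : (0 < hausdorff d.-1 (Xzero eta))%E)
    (X0_rectifiable : rectifiable d.-1 (Xzero eta))
    (beta_le : (beta <= gamma%:E^-1 * kappa gamma alpha)%E)
    (A_partition : forall s : R, 0 < s <= 1 -> cube_partition s (A s))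
    (S_sub : forall (n : nat) (s : R), s \in S n -> 0 < s <= 1)
    (S_net : forall n : nat, (0 < n)%N -> is_net (n%:R `^ (- d%:R^-1)) (S n))
    (S_poly : poly_card S)
    (sstar_TV : TV_selector A S sstar) :
  match beta with
  | b%:E =>
      learns_with_rate P (TV_HR A sstar)
        (fun n : nat => n%:R `^ (- rate_exponent d gamma alpha b))
  | _ =>
      forall b : R, 0 < b ->
        learns_with_rate P (TV_HR A sstar)
          (fun n : nat => n%:R `^ (- rate_exponent d gamma alpha b))
  end.
Proof.
case: beta beta_gt0 P_MNE beta_le => [b| |] // beta_gt0 P_MNE beta_le.
  apply: (learns_finite_beta P eta alpha b%:E gamma b A S sstar) => //.
  by left.
move=> b b0; apply: (learns_finite_beta P eta alpha +oo%E gamma b A S sstar) => //.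
by right.
Qed.
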